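(* Let $(\pi,\mathscr H)=\pi^{\sqrt2}_{2^{1/4},\,-2^{-1/4}}$ be the Jones representation of Thompson's group $F$ constructed from the Temperley-Lieb-Jones planar algebra with loop parameter $\delta=\sqrt2$ and the normalized element $R=2^{1/4}R_1-2^{-1/4}R_2$, let $\vec F<F$ be the Jones subgroup, let $\sigma_F$ be the automorphism of $F$ given by $\sigma_F(g)(x)=1-g(1-x)$, and let $\tilde\pi=\pi\circ\sigma_F$. Then the subgroups $\vec F$ and $\sigma_F(\vec F)$ of $F$ are not quasi-conjugate. In particular, the representations $\pi$ and $\tilde\pi$ are not unitarily equivalent.
   Context: Thompson's group $F$ is the group of orientation preserving piecewise linear homeomorphisms of $[0,1]$ with finitely many breakpoints, all at dyadic rationals, and slopes in $2^{\mathbb Z}$. Equivalently: a binary forest with $n$ roots and $m$ leaves is a planar forest, drawn with roots at the bottom and leaves at the top (numbered from left to right), all of whose branchings are binary; $f\circ g$ is $f$ stacked on top of $g$ (roots of $f$ glued to leaves of $g$); a tree is a forest with one root; $|$ is the trivial tree, $Y$ the tree with two leaves, $\bullet$ is horizontal concatenation. $F$ is the set of classes $\frac ts$ of pairs $(t,s)$ of trees with the same number of leaves, modulo $(t,s)\sim(f\circ t,f\circ s)$, with product $\frac ts\cdot\frac{t'}{s'}=\frac{p\circ t}{q\circ s'}$ whenever $p\circ s=q\circ t'$; $\frac ts$ is the homeomorphism mapping, piecewise affinely and in order, the standard dyadic partition of $[0,1]$ given by $s$ onto the one given by $t$. With $\sigma$ the reflection of forests in a vertical line, $\sigma_F(\frac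 ts)=\frac{\sigma(t)}{\sigma(s)}$. Temperley-Lieb-Jones category: for $m+n$ even, $\mathrm{Rec}(m,n)$ is the complex span of non-crossing pairings of $m$ points on the bottom and $n$ points on the top of a rectangle; composition is vertical concatenation, each closed loop being replaced by the factor $\delta$; $\dagger$ is the antilinear reflection in a horizontal line; $\bullet$ is horizontal concatenation. One takes the quotient by the kernel of the positive semidefinite forms, so that $\mathrm{Rec}(1,n)$ is a Hilbert space with $\langle x,y\rangle=y^\dagger\circ x\in \mathrm{Rec}(1,1)=\mathbb C$. Jones representation $\pi^\delta_{a,b}$: here $R_1=|\,|$ and $R_2={}^{\cup}_{\cap}$ in $\mathrm{Rec}(2,2)$. For $a,b\in\mathbb C$ with $\delta(|a|^2+|b|^2)+a\bar b+\bar a b=1$ put $R=aR_1+bR_2$; bending its bottom right string up to the top right gives the isometry $\rho=a(|\bullet\cup)+b(\cup\bullet|)\in\mathrm{Rec}(1,3)$. For the forest $f$ with $n$ roots whose only branching is one $Y$ at the $k$-th root set $\Phi(f)=\mathrm{id}_{2k-2}\bullet\rho\bullet\mathrm{id}_{2n-2k}\in\mathrm{Rec}(2n-1,2n+1)$, and extend by $\Phi(f\circ g)=\Phi(f)\circ\Phi(g)$. For a tree $t$ with $n$ leaves let $\mathfrak H_t$ be a copy, indexed by $t$, of the span in $\mathrm{Rec}(1,2n-1)$ of all $\Phi(s)$, $s$ a tree with $n$ leaves. $\mathscr H$ is the completion of the inductive limit of the $\mathfrak H_t$ along the isometries $(t,\xi)\mapsto(f\circ t,\Phi(f)\circ\xi)$,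 the vacuum vector is $\Omega=(|,1)\in\mathscr H$, and $\pi$ is the unitary representation determined by $\pi(\frac ts)(v,\xi)=(p\circ t,\Phi(q)\circ\xi)$ where $p\circ s=q\circ v$. Jones subgroup: $\vec F=\{g\in F:\pi(g)\Omega=\Omega\}$ for $\pi=\pi^{\sqrt2}_{2^{1/4},-2^{-1/4}}$. By a known theorem of Golan and Sapir, $\vec F=\{g\in F: gS=S\}$ where $S$ is the set of dyadic rationals in $(0,1)$ with binary expansion $.a_1\cdots a_n1$ such that the number of $1\le i\le n$ with $a_i=1$ is even. Two subgroups $A,B$ of a group $G$ are commensurable if $A\cap B$ has finite index in both $A$ and $B$; they are quasi-conjugate if there is $g\in G$ such that $A$ and $gBg^{-1}$ are commensurable. *)

(* Defs.v *)
From HB Require Import structures.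
From mathcomp Require Import all_boot all_order all_algebra.
From mathcomp Require Import generic_quotient zify ring lra complex.
From mathcomp Require Import all_classical all_reals all_analysis.

Set Implicit Arguments.
Unset Strict Implicit.
Unset Printing Implicit Defensive.

Import Order.TTheory GRing.Theory Num.Theory numFieldNormedType.Exports.

Local Open Scope quotient_scope.

(** * Binary forests *)

Inductive tree := Leaf | Node of tree & tree.

HB.instance Definition _ := gen_eqMixin tree.
HB.instance Definition _ := gen_choiceMixin tree.

Fixpoint leaves (t : tree) : nat :=
  if t is Node l r then leaves l + leaves r else 1.

Fixpoint mirror (t : tree) : tree :=
  if t is Node l r then Node (mirror r) (mirror l) else Leaf.

Definition fleaves (f : seq tree) : nat := sumn (map leaves f).

(* [graft t f] glues the roots of [f], in order, to the leaves of [t]. *)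
Fixpoint graft (t : tree) (f : seq tree) : tree :=
  if t is Node l r
  then Node (graft l (take (leaves l) f)) (graft r (drop (leaves l) f))
  else head Leaf f.

Fixpoint fgraft (g f : seq tree) : seq tree :=
  if g is t :: g'
  then graft t (take (leaves t) f) :: fgraft g' (drop (leaves t) f)
  else [::].

Lemma fleaves_cat f g : fleaves (f ++ g) = fleaves f + fleaves g.
Proof. by rewrite /fleaves map_cat sumn_cat. Qed.

Lemma seq_split (T : Type) m n (s : seq T) : size s = m + n ->
  exists s1 s2, [/\ s = s1 ++ s2, size s1 = m & size s2 = n].
Proof.
move=> hs; exists (take m s), (drop m s); rewrite cat_take_drop size_drop.
by split=> //; [rewrite size_takel // hs leq_addr | rewrite hs addKn].
Qed.

Lemma graft_node l r f1 f2 : size f1 = leaves l ->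
  graft (Node l r) (f1 ++ f2) = Node (graft l f1) (graft r f2).
Proof. by move=> h /=; rewrite take_size_cat // drop_size_cat. Qed.

Lemma fgraft_cons t g f1 f2 : size f1 = leaves t ->
  fgraft (t :: g) (f1 ++ f2) = graft t f1 :: fgraft g f2.
Proof. by move=> h /=; rewrite take_size_cat // drop_size_cat. Qed.

Lemma size_fgraft g f : size (fgraft g f) = size g.
Proof. by elim: g f => //= t g IH f; rewrite IH. Qed.

Lemma leaves_graft t f : size f = leaves t -> leaves (graft t f) = fleaves f.
Proof.
elim: t f => [|l IHl r IHr] f /=.
  by case: f => [|u [|]] //= _; rewrite /fleaves /= addn0.
case/seq_split=> f1 [f2 [-> h1 h2]].
by rewrite take_size_cat // drop_size_cat //= IHl // IHr // fleaves_cat.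
Qed.

Lemma fleaves_fgraft g f :
  size f = fleaves g -> fleaves (fgraft g f) = fleaves f.
Proof.
elim: g f => [|t g IH] f; first by case: f.
case/seq_split=> f1 [f2 [-> h1 h2]].
rewrite fgraft_cons // fleaves_cat -(leaves_graft h1) -(IH f2) //.
Qed.

Lemma fgraft_cat g1 g2 f1 f2 : size f1 = fleaves g1 ->
  fgraft (g1 ++ g2) (f1 ++ f2) = fgraft g1 f1 ++ fgraft g2 f2.
Proof.
elim: g1 f1 => [|t g IH] f; first by case: f.
case/seq_split=> a [b [-> h1 h2]].
by rewrite cat_cons -catA !fgraft_cons // IH.
Qed.

Lemma graftA t g f : size g = leaves t -> size f = fleaves g ->
  graft (graft t g) f = graft t (fgraft g f).
Proof.
elim: t g f => [|l IHl r IHr] g f.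
  case: g => [|u [|]] //= _ h.
  by rewrite take_oversize // h /fleaves /= addn0.
case/seq_split=> g1 [g2 [-> h1 h2]]; rewrite fleaves_cat.
case/seq_split=> f1 [f2 [-> k1 k2]].
rewrite fgraft_cat // !graft_node ?size_fgraft ?leaves_graft //.
by rewrite IHl // IHr.
Qed.

Lemma fgraftA h g f : size g = fleaves h -> size f = fleaves g ->
  fgraft (fgraft h g) f = fgraft h (fgraft g f).
Proof.
elim: h g f => [|t h IH] g f //.
case/seq_split=> g1 [g2 [-> h1 h2]]; rewrite fleaves_cat.
case/seq_split=> f1 [f2 [-> k1 k2]].
rewrite fgraft_cat // !fgraft_cons ?size_fgraft ?leaves_graft //.
by rewrite graftA // IH.
Qed.

Lemma graft1 t : graft t (nseq (leaves t) Leaf) = t.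
Proof.
elim: t => //= l IHl r IHr; rewrite nseqD.
by rewrite take_size_cat ?drop_size_cat ?size_nseq // IHl IHr.
Qed.

Lemma fgraft1 g : fgraft g (nseq (fleaves g) Leaf) = g.
Proof.
elim: g => // t g IH; rewrite [fleaves _]/(leaves t + fleaves g)%N nseqD.
by rewrite fgraft_cons ?size_nseq // graft1 IH.
Qed.

Lemma fgraft1l f : fgraft (nseq (size f) Leaf) f = f.
Proof. by elim: f => //= t f IH; rewrite drop0 IH. Qed.

Lemma graft_inj t f g : size f = leaves t -> size g = leaves t ->
  graft t f = graft t g -> f = g.
Proof.
elim: t f g => [|l IHl r IHr] f g.
  by case: f => [|? [|]] //; case: g => [|? [|]] //= _ _ ->.
case/seq_split=> f1 [f2 [-> h1 h2]]; case/seq_split=> g1 [g2 [-> k1 k2]].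
by rewrite !graft_node // => -[/(IHl _ _ h1 k1)-> /(IHr _ _ h2 k2)->].
Qed.

Lemma fgraft_inj h f g : size f = fleaves h -> size g = fleaves h ->
  fgraft h f = fgraft h g -> f = g.
Proof.
elim: h f g => [|t h IH] f g; first by case: f; case: g.
case/seq_split=> f1 [f2 [-> h1 h2]]; case/seq_split=> g1 [g2 [-> k1 k2]].
by rewrite !fgraft_cons // => -[/(graft_inj h1 k1)-> /(IH _ _ h2 k2)->].
Qed.

Lemma graft_ore t u : exists p q,
  [/\ size p = leaves t, size q = leaves u & graft t p = graft u q].
Proof.
elim: t u => [|l IHl r IHr] u.
  by exists [:: u], (nseq (leaves u) Leaf); rewrite size_nseq graft1.
case: u => [|l' r'].
  exists (nseq (leaves (Node l r)) Leaf), [:: Node l r].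
  by rewrite size_nseq graft1.
have [p1 [q1 [a1 b1 c1]]] := IHl l'; have [p2 [q2 [a2 b2 c2]]] := IHr r'.
exists (p1 ++ p2), (q1 ++ q2); rewrite !graft_node // c1 c2 !size_cat.
by rewrite a1 a2 b1 b2.
Qed.

Lemma fgraft_ore f g : size f = size g -> exists p q,
  [/\ size p = fleaves f, size q = fleaves g & fgraft f p = fgraft g q].
Proof.
elim: f g => [|t f IH] [|u g] //; first by exists [::], [::].
case=> /IH[p2 [q2 [a2 b2 c2]]]; have [p1 [q1 [a1 b1 c1]]] := graft_ore t u.
exists (p1 ++ p2), (q1 ++ q2); rewrite !fgraft_cons // c1 c2 !size_cat.
by rewrite a1 a2 b1 b2.
Qed.

Lemma leaves_mirror t : leaves (mirror t) = leaves t.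
Proof. by elim: t => //= l -> r ->; rewrite addnC. Qed.

Lemma fleaves_mirror f : fleaves (rev (map mirror f)) = fleaves f.
Proof.
by rewrite /fleaves map_rev sumn_rev -map_comp (eq_map leaves_mirror).
Qed.

Lemma mirror_graft t f : size f = leaves t ->
  mirror (graft t f) = graft (mirror t) (rev (map mirror f)).
Proof.
elim: t f => [|l IHl r IHr] f; first by case: f => [|u []].
case/seq_split=> f1 [f2 [-> h1 h2]].
rewrite graft_node // map_cat rev_cat [mirror (Node l r)]/= graft_node.
  by rewrite -IHl // -IHr.
by rewrite size_rev size_map leaves_mirror.
Qed.

Lemma mirror_fgraft g f : size f = fleaves g ->
  rev (map mirror (fgraft g f)) =
  fgraft (rev (map mirror g)) (rev (map mirror f)).
Proof.
elim: g f => [|t g IH] f //; case/seq_split=> f1 [f2 [-> h1 h2]].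
rewrite fgraft_cons // map_cat rev_cat /= !rev_cons -!cats1.
rewrite fgraft_cat ?size_rev ?size_map ?fleaves_mirror // -IH //.
congr (_ ++ _); rewrite /= take_oversize ?mirror_graft //.
by rewrite size_rev size_map leaves_mirror h1.
Qed.

Record forest (n m : nat) := Forest {
  trees_of :> seq tree;
  _ : (size trees_of == n) && (fleaves trees_of == m) }.

HB.instance Definition _ n m := [isSub for @trees_of n m].
HB.instance Definition _ n m := [Choice of forest n m by <:].

Lemma size_forest n m (f : forest n m) : size f = n.
Proof. by have /andP[/eqP] := valP f. Qed.

Lemma leaves_forest n m (f : forest n m) : fleaves f = m.
Proof. by have /andP[_ /eqP] := valP f. Qed.

Fact fid_subproof n :
  (size (nseq n Leaf) == n) && (fleaves (nseq n Leaf) == n).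
Proof. by rewrite size_nseq /fleaves map_nseq sumn_nseq mul1n !eqxx. Qed.
Definition fid n : forest n n := Forest (fid_subproof n).

Fact fcomp_subproof n m k (f : forest m k) (g : forest n m) :
  (size (fgraft g f) == n) && (fleaves (fgraft g f) == k).
Proof.
rewrite size_fgraft size_forest fleaves_fgraft ?leaves_forest ?eqxx //.
by rewrite size_forest.
Qed.
(* [fcomp f g] is [f] stacked on top of [g]. *)
Definition fcomp n m k (f : forest m k) (g : forest n m) : forest n k :=
  Forest (fcomp_subproof f g).

Fact fcaret_subproof n (k : 'I_n) :
  let f := nseq k Leaf ++ Node Leaf Leaf :: nseq (n - k.+1) Leaf in
  (size f == n) && (fleaves f == n.+1).
Proof.
rewrite /= size_cat /= !size_nseq fleaves_cat /fleaves /= !map_nseq !sumn_nseq.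
rewrite !mul1n; have := ltn_ord k; move: (nat_of_ord k) => j hj.
by apply/andP; split; apply/eqP; lia.
Qed.
(* The forest whose only branching is one [Y] at the root [k] (from 0). *)
Definition fcaret n (k : 'I_n) : forest n n.+1 := Forest (fcaret_subproof k).

Fact fmirror_subproof n m (f : forest n m) :
  let f' := rev (map mirror f) in (size f' == n) && (fleaves f' == m).
Proof.
by rewrite /= size_rev size_map fleaves_mirror size_forest leaves_forest !eqxx.
Qed.
Definition fmirror n m (f : forest n m) : forest n m :=
  Forest (fmirror_subproof f).

Lemma fcompA n m k l (f : forest k l) (g : forest m k) (h : forest n m) :
  fcomp f (fcomp g h) = fcomp (fcomp f g) h.
Proof.
by apply/val_inj; rewrite /= fgraftA // ?size_forest ?leaves_forest.
Qed.

Lemma fcomp1f n m (f : forest n m) : fcomp (fid m) f = f.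
Proof. by apply/val_inj; have := fgraft1 f; rewrite leaves_forest. Qed.

Lemma fcompf1 n m (f : forest n m) : fcomp f (fid n) = f.
Proof. by apply/val_inj; have := fgraft1l f; rewrite size_forest. Qed.

Lemma fcompI n m k (f g : forest m k) (h : forest n m) :
  fcomp f h = fcomp g h -> f = g.
Proof.
move=> [e]; apply/val_inj; apply: fgraft_inj e; 
  by rewrite size_forest leaves_forest.
Qed.

Lemma fcomp_ore n m m' (f : forest n m) (g : forest n m') :
  exists k (p : forest m k) (q : forest m' k), fcomp p f = fcomp q g.
Proof.
have /fgraft_ore[p [q []]] : size f = size g by rewrite !size_forest.
rewrite !leaves_forest => sp sq e.
have lq : fleaves q = fleaves p.
  by rewrite -(@fleaves_fgraft f p) ?e ?fleaves_fgraft ?leaves_forest.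
have hp : (size p == m) && (fleaves p == fleaves p) by rewrite sp !eqxx.
have hq : (size q == m') && (fleaves q == fleaves p) by rewrite sq lq !eqxx.
by exists (fleaves p), (Forest hp), (Forest hq); apply/val_inj.
Qed.

Lemma fmirror_comp n m k (f : forest m k) (g : forest n m) :
  fmirror (fcomp f g) = fcomp (fmirror f) (fmirror g).
Proof.
by apply/val_inj; rewrite /= mirror_fgraft // size_forest leaves_forest.
Qed.

(** * Thompson's group F *)

Record tree_pair := TreePair {
  tp_size : nat;
  tp_num : forest 1 tp_size;
  tp_den : forest 1 tp_size }.

HB.instance Definition _ := gen_eqMixin tree_pair.
HB.instance Definition _ := gen_choiceMixin tree_pair.

Definition tp_equiv (x y : tree_pair) : bool :=
  `[< exists k (f : forest (tp_size x) k) (g : forest (tp_size y) k),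
        fcomp f (tp_num x) = fcomp g (tp_num y) /\
        fcomp f (tp_den x) = fcomp g (tp_den y) >].

Fact tp_equiv_refl : reflexive tp_equiv.
Proof. by move=> x; apply/asboolP; exists (tp_size x), (fid _), (fid _). Qed.

Fact tp_equiv_sym : symmetric tp_equiv.
Proof.
move=> x y; apply/asboolP/asboolP=> -[k [f [g [e1 e2]]]];
  by exists k, g, f; split.
Qed.

Fact tp_equiv_trans : transitive tp_equiv.
Proof.
move=> y x z /asboolP[k [f [g [e1 e2]]]] /asboolP[l [f' [g' [e1' e2']]]].
have [m [p [q e]]] := fcomp_ore g f'.
apply/asboolP; exists m, (fcomp p f), (fcomp q g').
by rewrite -!fcompA e1 e2 -e1' -e2' !fcompA e.
Qed.

Canonical tp_equiv_equiv :=
  EquivRel tp_equiv tp_equiv_refl tp_equiv_sym tp_equiv_trans.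

Definition thompsonF := {eq_quot tp_equiv}.
HB.instance Definition _ : EqQuotient _ tp_equiv thompsonF :=
  EqQuotient.on thompsonF.
HB.instance Definition _ := Choice.on thompsonF.

(* The class of the pair of trees [t], [s]. *)
Definition frac n (t s : forest 1 n) : thompsonF :=
  (\pi_thompsonF (TreePair t s))%qT.

Lemma fracP n m (t s : forest 1 n) (t' s' : forest 1 m) :
  frac t s = frac t' s' <-> exists k (f : forest n k) (g : forest m k),
    fcomp f t = fcomp g t' /\ fcomp f s = fcomp g s'.
Proof. by split=> [/eqquotP/asboolP|h] //; apply/eqquotP/asboolP. Qed.

Lemma frac_comp n k (f : forest n k) (t s : forest 1 n) :
  frac (fcomp f t) (fcomp f s) = frac t s.
Proof. by apply/fracP; exists k, (fid k), f; rewrite !fcomp1f. Qed.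

Lemma fracW (P : thompsonF -> Prop) :
  (forall n (t s : forest 1 n), P (frac t s)) -> forall g, P g.
Proof. by move=> h; elim/quotW=> -[n t s]; apply: h. Qed.

(* [frac_mul] below is the product formula, for any [p] and [q] such that
   [fcomp p s = fcomp q t']. *)
Definition tp_mul (x y : tree_pair) : tree_pair :=
  let k := cid (fcomp_ore (tp_den x) (tp_num y)) in
  let p := cid (svalP k) in
  let q := cid (svalP p) in
  TreePair (fcomp (sval p) (tp_num x)) (fcomp (sval q) (tp_den y)).

Definition thompson_mul (g h : thompsonF) : thompsonF :=
  (\pi_thompsonF (tp_mul (repr g) (repr h)))%qT.

Definition thompson_one : thompsonF := frac (fid 1) (fid 1).

Definition thompson_inv (g : thompsonF) : thompsonF :=
  frac (tp_den (repr g)) (tp_num (repr g)).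

Lemma frac_repr (g : thompsonF) :
  frac (tp_num (repr g)) (tp_den (repr g)) = g.
Proof.
rewrite /frac -[RHS]reprK; congr (\pi_thompsonF _)%qT.
by case: (repr g).
Qed.


Lemma frac_mul_choice n m k l (t s : forest 1 n) (t' s' : forest 1 m)
    (p : forest n k) (q : forest m k) (p2 : forest n l) (q2 : forest m l) :
  fcomp p s = fcomp q t' -> fcomp p2 s = fcomp q2 t' ->
  frac (fcomp p t) (fcomp q s') = frac (fcomp p2 t) (fcomp q2 s').
Proof.
move=> e e2; have [u [a [b ab]]] := fcomp_ore p p2.
have ab' : fcomp a q = fcomp b q2.
  by apply: (@fcompI _ _ _ _ _ t'); rewrite -!fcompA -e -e2 !fcompA ab.
by apply/fracP; exists u, a, b; rewrite !fcompA ab ab'.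
Qed.

Lemma thompson_mulE n m k (t s : forest 1 n) (t' s' : forest 1 m)
    (p : forest n k) (q : forest m k) : fcomp p s = fcomp q t' ->
  thompson_mul (frac t s) (frac t' s') = frac (fcomp p t) (fcomp q s').
Proof.
move=> e; rewrite /thompson_mul /tp_mul.
have := frac_repr (frac t s); move: (repr (frac t s)) => [n' a b] /=.
move=> /esym/fracP[v [f [g [f1 f2]]]].
have := frac_repr (frac t' s'); move: (repr (frac t' s')) => [m' c d] /=.
move=> /esym/fracP[v' [f' [g' [f1' f2']]]].
set K := cid _; set P := cid _; set Q := cid _.
have /= := svalP Q; move: (sval Q) => /= {Q} Q.
move: (sval P) Q => {P} P; move: (sval K) P => {K} K P Q e2.
have [u [i [j ij]]] := fcomp_ore p f.
have [u' [i' [j' ij']]] := fcomp_ore (fcomp i q) f'.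
have h : fcomp (fcomp (fcomp i' j) g) b = fcomp (fcomp j' g') c.
  rewrite -!fcompA -f1' -f2 !fcompA -ij' -!fcompA -e.
  by rewrite !(fcompA j) -ij -!fcompA.
rewrite -/(frac _ _) (frac_mul_choice a d e2 h).
rewrite -[RHS](frac_comp (fcomp i' i)); congr frac.
  by rewrite -!fcompA -f1 !(fcompA j) -ij !fcompA.
by rewrite -!fcompA -f2' !(fcompA j') -ij' !fcompA.
Qed.

Fact thompson_mulA : associative thompson_mul.
Proof.
elim/fracW=> n t s; elim/fracW=> m t' s'; elim/fracW=> l t2 s2.
have [k [p [q e]]] := fcomp_ore s t'.
have [k' [r [u e']]] := fcomp_ore (fcomp q s') t2.
rewrite (thompson_mulE _ _ e) (thompson_mulE _ _ e').
have e2 : fcomp (fcomp r q) s' = fcomp u t2 by rewrite -fcompA.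
have e3 : fcomp (fcomp r p) s = fcomp (fid _) (fcomp (fcomp r q) t').
  by rewrite fcomp1f -!fcompA e.
by rewrite (thompson_mulE _ _ e2) (thompson_mulE _ _ e3) fcomp1f fcompA.
Qed.

Fact thompson_mul1 : left_id thompson_one thompson_mul.
Proof.
elim/fracW=> n t s; rewrite /thompson_one.
have e : fcomp t (fid 1) = fcomp (fid n) t by rewrite fcompf1 fcomp1f.
by rewrite (thompson_mulE _ _ e) e !fcomp1f.
Qed.

Fact thompson_mulr1 : right_id thompson_one thompson_mul.
Proof.
elim/fracW=> n t s; rewrite /thompson_one.
have e : fcomp (fid n) s = fcomp s (fid 1) by rewrite fcompf1 fcomp1f.
by rewrite (thompson_mulE _ _ e) -e !fcomp1f.
Qed.

Lemma frac_id n (t : forest 1 n) : frac t t = thompson_one.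
Proof. by rewrite /thompson_one -(frac_comp t (fid 1)) fcompf1. Qed.

Fact thompson_mulV : left_inverse thompson_one thompson_inv thompson_mul.
Proof.
move=> g; rewrite /thompson_inv -[in X in thompson_mul _ X](frac_repr g).
by rewrite (@thompson_mulE _ _ _ _ _ _ _ (fid _) (fid _)) // !fcomp1f frac_id.
Qed.

Fact thompson_mulVr : right_inverse thompson_one thompson_inv thompson_mul.
Proof.
move=> g; rewrite /thompson_inv -[in X in thompson_mul X _](frac_repr g).
by rewrite (@thompson_mulE _ _ _ _ _ _ _ (fid _) (fid _)) // !fcomp1f frac_id.
Qed.

HB.instance Definition _ := isGroup.Build thompsonF
  thompson_mulA thompson_mul1 thompson_mulr1 thompson_mulV thompson_mulVr.

Lemma frac_mul n m k (t s : forest 1 n) (t' s' : forest 1 m)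
    (p : forest n k) (q : forest m k) : fcomp p s = fcomp q t' ->
  (frac t s * frac t' s' = frac (fcomp p t) (fcomp q s'))%g.
Proof. exact: thompson_mulE. Qed.

(* [homeo_sigmaF] below: [sigmaF g x = 1 - g (1 - x)] on [0, 1]. *)
Definition sigmaF (g : thompsonF) : thompsonF :=
  frac (fmirror (tp_num (repr g))) (fmirror (tp_den (repr g))).

Lemma sigmaF_frac n (t s : forest 1 n) :
  sigmaF (frac t s) = frac (fmirror t) (fmirror s).
Proof.
rewrite /sigmaF; have /fracP[k [f [g [e1 e2]]]] := frac_repr (frac t s).
apply/fracP; exists k, (fmirror f), (fmirror g).
by rewrite -!fmirror_comp e1 e2.
Qed.

Fact sigmaF_mul (g h : thompsonF) : sigmaF (g * h)%g = (sigmaF g * sigmaF h)%g.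
Proof.
move: g h; elim/fracW=> n t s; elim/fracW=> m t' s'.
have [k [p [q e]]] := fcomp_ore s t'.
have e' : fcomp (fmirror p) (fmirror s) = fcomp (fmirror q) (fmirror t').
  by rewrite -!fmirror_comp e.
by rewrite (frac_mul _ _ e) !sigmaF_frac (frac_mul _ _ e') !fmirror_comp.
Qed.

Lemma mirrorK : involutive mirror.
Proof. by elim=> //= l -> r ->. Qed.

Lemma fmirrorK n m : involutive (@fmirror n m).
Proof.
by move=> f; apply/val_inj; rewrite /= map_rev revK -map_comp map_id_in // =>
  t _ /=; rewrite mirrorK.
Qed.

Fact sigmaFK : involutive sigmaF.
Proof. by elim/fracW=> n t s; rewrite !sigmaF_frac !fmirrorK. Qed.

Local Open Scope ring_scope.

Section Homeomorphism.
Variable R : realFieldType.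
Implicit Types (ws vs us : seq R) (x : R).

(* Lengths of the intervals of the standard dyadic partition given by [t]. *)
Fixpoint widths (t : tree) : seq R :=
  if t is Node l r then [seq w / 2 | w <- widths l ++ widths r] else [:: 1].

(* The map sending successive intervals of lengths [ws] affinely onto
   successive intervals of lengths [vs], both starting at 0. *)
Fixpoint pl_map (ws vs : seq R) (x : R) : R :=
  match ws, vs with
  | w :: ws', v :: vs' =>
      if x <= w then x * (v / w) else v + pl_map ws' vs' (x - w)
  | _, _ => x
  end.

(* [g] as a homeomorphism of [0, 1] (see [homeo_frac]). *)
Definition homeo (g : thompsonF) : R -> R :=
  pl_map (widths (head Leaf (tp_den (repr g))))
         (widths (head Leaf (tp_num (repr g)))).

Let pos ws := all (fun w => 0 < w) ws.

Let sumr ws := \sum_(w <- ws) w.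

Let sumr_ge0 ws : pos ws -> 0 <= sumr ws.
Proof.
by move/allP=> h; rewrite /sumr big_seq; apply: sumr_ge0 => w /h /ltW.
Qed.

Let sumr_cons w ws : sumr (w :: ws) = w + sumr ws.
Proof. exact: big_cons. Qed.

Let sumr_cat ws vs : sumr (ws ++ vs) = sumr ws + sumr vs.
Proof. exact: big_cat. Qed.

Let sumr_rev ws : sumr (rev ws) = sumr ws.
Proof. by apply: perm_big; rewrite perm_rev. Qed.

Let sumr_scale a ws : sumr [seq a * w | w <- ws] = a * sumr ws.
Proof. by rewrite /sumr big_map mulr_sumr. Qed.

Let pos_scale a ws : 0 < a -> pos ws -> pos [seq a * w | w <- ws].
Proof.
by move=> a0 /allP h; apply/allP=> _ /mapP[w /h w0 ->]; apply: mulr_gt0.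
Qed.

Let widths_node l r :
  widths (Node l r) = [seq 2^-1 * w | w <- widths l ++ widths r].
Proof. by apply: eq_map => w; rewrite mulrC. Qed.

Lemma size_widths t : size (widths t) = leaves t.
Proof. by elim: t => //= l IHl r IHr; rewrite size_map size_cat IHl IHr. Qed.

Let widths_gt0 t : pos (widths t).
Proof.
elim: t => [|l IHl r IHr]; first by rewrite /pos /= ltr01.
rewrite widths_node; apply: pos_scale; first by rewrite invr_gt0 ltr0n.
by rewrite /pos all_cat; apply/andP.
Qed.

Let sum_widths t : sumr (widths t) = 1.
Proof.
elim: t => [|l IHl r IHr]; first by rewrite /sumr /= big_seq1.
by rewrite widths_node sumr_scale sumr_cat IHl IHr; field.
Qed.

Lemma pl_map0 ws vs : pos ws -> pl_map ws vs 0 = 0.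
Proof.
by case: ws vs => [|w ws] [|v vs] //= /andP[/ltW-> _]; rewrite mul0r.
Qed.

Let pl_map_cat ws vs ws' vs' x : size ws = size vs -> pos ws -> pos ws' ->
  0 <= x -> pl_map (ws ++ ws') (vs ++ vs') x =
  if x <= sumr ws then pl_map ws vs x
  else sumr vs + pl_map ws' vs' (x - sumr ws).
Proof.
elim: ws vs x => [|w ws IH] [|v vs] x //=.
  move=> _ _ p x0; rewrite /sumr !big_nil subr0 add0r.
  by case: leP => // x0'; rewrite (_ : x = 0) ?pl_map0 //; lra.
move=> [sz] /andP[w0 p] p' x0; have := sumr_ge0 p.
rewrite !sumr_cons => s0; case: (leP x w) => xw.
  by rewrite ifT //; lra.
rewrite IH //; last by lra.
have -> : (x - w <= sumr ws) = (x <= w + sumr ws).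
  by apply/idP/idP => ?; lra.
by case: ifP => // _; rewrite opprD !addrA.
Qed.

Let pl_map_scale w v ws x : 0 < w -> pos ws -> 0 <= x <= w * sumr ws ->
  pl_map [seq w * u | u <- ws] [seq v * u | u <- ws] x = x * (v / w).
Proof.
move=> w0; elim: ws x => [|u ws IH] x /=.
  rewrite /sumr big_nil mulr0 => _ /andP[x0 x1].
  by rewrite (_ : x = 0) ?mul0r //; lra.
move=> /andP[u0 p]; rewrite sumr_cons => /andP[x0 x1].
case: leP => xw; first by field; rewrite !lt0r_neq0.
rewrite IH //; first by field; rewrite lt0r_neq0.
by apply/andP; split; lra.
Qed.

Fixpoint refine ws (f : seq tree) : seq R :=
  match ws, f with
  | w :: ws', u :: f' => [seq w * x | x <- widths u] ++ refine ws' f'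
  | _, _ => [::]
  end.

Let refine_cat ws ws' f f' : size ws = size f ->
  refine (ws ++ ws') (f ++ f') = refine ws f ++ refine ws' f'.
Proof. by elim: ws f => [|w ws IH] [|u f] //= [/IH->]; rewrite catA. Qed.

Let refine_scale a ws f :
  refine [seq a * w | w <- ws] f = [seq a * w | w <- refine ws f].
Proof.
elim: ws f => [|w ws IH] [|u f] //=; rewrite map_cat IH -map_comp.
by congr (_ ++ _); apply: eq_map => x /=; rewrite mulrA.
Qed.

Let widths_graft t f :
  size f = leaves t -> widths (graft t f) = refine (widths t) f.
Proof.
elim: t f => [|l IHl r IHr] f.
  case: f => [|u [|]] //= _; rewrite cats0 -[LHS]map_id.
  by apply: eq_map => x; rewrite mul1r.
case/seq_split=> f1 [f2 [-> h1 h2]].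
rewrite graft_node // !widths_node refine_scale IHl // IHr // refine_cat //.
by rewrite size_widths h1.
Qed.

Let pos_refine ws f : pos ws -> pos (refine ws f).
Proof.
elim: ws f => [|w ws IH] [|u f] //= /andP[w0 /(IH f) h].
by rewrite /pos all_cat; apply/andP; split=> //; apply: pos_scale.
Qed.

Let pl_map_refine ws vs f x : size ws = size f -> size vs = size f ->
  pos ws -> 0 <= x <= sumr ws ->
  pl_map (refine ws f) (refine vs f) x = pl_map ws vs x.
Proof.
elim: ws vs f x => [|w ws IH] [|v vs] [|u f] x //= [s1] [s2].
move=> /andP[w0 p]; rewrite sumr_cons => /andP[x0 x1].
rewrite pl_map_cat ?size_map //; [|exact: pos_scale|exact: pos_refine].
rewrite !sumr_scale sum_widths !mulr1; case: leP => xw.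
  by rewrite pl_map_scale // sum_widths mulr1 x0.
by rewrite IH //; apply/andP; split; lra.
Qed.

Let pl_map_rev ws vs x : size ws = size vs -> pos ws -> 0 <= x <= sumr ws ->
  pl_map (rev ws) (rev vs) x = sumr vs - pl_map ws vs (sumr ws - x).
Proof.
elim: ws vs x => [|w ws IH] [|v vs] x //.
  by move=> _ _; rewrite /sumr !big_nil /=; lra.
move=> [sz] /= /andP[w0 p] /andP[x0]; rewrite !rev_cons -!cats1 !sumr_cons.
move=> x1; rewrite pl_map_cat ?size_rev //; last 2 first.
- by rewrite /pos all_rev.
- by rewrite /pos /= w0.
rewrite !sumr_rev /=; case: (leP x (sumr ws)) => xs.
  rewrite IH ?x0 //; case: leP => y.
    have -> : x = sumr ws by lra.
    by rewrite subrr pl_map0 //; field; rewrite lt0r_neq0.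
  by rewrite (_ : w + sumr ws - x - w = sumr ws - x); lra.
rewrite ifT; last by lra.
by rewrite ifT; [field; rewrite lt0r_neq0 | lra].
Qed.

Let pl_map_le us vs x : size us = size vs -> pos us -> pos vs ->
  0 <= x <= sumr us -> 0 <= pl_map us vs x <= sumr vs.
Proof.
elim: us vs x => [|u us IH] [|v vs] x //.
move=> [sz] /= /andP[u0 p] /andP[v0 q]; rewrite !sumr_cons => /andP[x0 x1].
have := sumr_ge0 q; case: (leP x u) => xu vs0.
  apply/andP; split; first by rewrite mulr_ge0 // divr_ge0 // ltW.
  apply: (@le_trans _ _ v); last by lra.
  by rewrite mulrCA ger_pMr // ler_pdivrMr // mul1r.
have h : 0 <= x - u <= sumr us by apply/andP; split; lra.
by have /andP[? ?] := IH vs _ sz p q h; apply/andP; split; lra.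
Qed.

Let pl_map_gt0 us vs x : size us = size vs -> pos us -> pos vs ->
  0 < x <= sumr us -> 0 < pl_map us vs x.
Proof.
case: us vs => [|u us] [|v vs] //.
  by move=> _ _ _; rewrite /sumr !big_nil => /andP[]; lra.
move=> [sz] /= /andP[u0 p] /andP[v0 q]; rewrite !sumr_cons => /andP[x0 x1].
case: (leP x u) => xu; first by rewrite mulr_gt0 // divr_gt0.
have h : 0 <= x - u <= sumr us by apply/andP; split; lra.
by have /andP[? ?] := pl_map_le sz p q h; lra.
Qed.

Let pl_map_comp us vs ws x : size us = size vs -> size vs = size ws ->
  pos us -> pos vs -> 0 <= x <= sumr us ->
  pl_map vs ws (pl_map us vs x) = pl_map us ws x.
Proof.
elim: us vs ws x => [|u us IH] [|v vs] [|w ws] x //= [s1] [s2].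
move=> /andP[u0 p] /andP[v0 q]; rewrite sumr_cons => /andP[x0 x1].
case: (leP x u) => xu.
  rewrite ifT; first by field; rewrite !lt0r_neq0.
  by rewrite mulrCA ger_pMr // ler_pdivrMr // mul1r.
have h : 0 < pl_map us vs (x - u) by rewrite pl_map_gt0 //; apply/andP; split; lra.
rewrite ifF; last by lra.
by rewrite addrAC subrr add0r IH //; apply/andP; split; lra.
Qed.

Let leaves_head n (t : forest 1 n) : leaves (head Leaf t) = n.
Proof.
by have := leaves_forest t; case: t => -[|t [|? ?]] //= _; rewrite /fleaves
  /= addn0.
Qed.

Let head_fcomp n m (f : forest n m) (t : forest 1 n) :
  head Leaf (fcomp f t) = graft (head Leaf t) f.
Proof.
have := leaves_head t; case: t => -[|t [|? ?]] //= _ e.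
by rewrite take_oversize // size_forest e.
Qed.

Let pl_map_fcomp n m (f : forest n m) (t s : forest 1 n) x : 0 <= x <= 1 ->
  pl_map (widths (head Leaf (fcomp f s))) (widths (head Leaf (fcomp f t))) x =
  pl_map (widths (head Leaf s)) (widths (head Leaf t)) x.
Proof.
move=> x01; rewrite !head_fcomp !widths_graft ?leaves_head ?size_forest //.
by rewrite pl_map_refine ?size_widths ?leaves_head ?size_forest ?sum_widths.
Qed.

Lemma homeo_frac n (t s : forest 1 n) x : 0 <= x <= 1 ->
  homeo (frac t s) x = pl_map (widths (head Leaf s)) (widths (head Leaf t)) x.
Proof.
move=> x01; have /fracP[k [f [g [e1 e2]]]] := frac_repr (frac t s).
by rewrite /homeo -(pl_map_fcomp f) // e1 e2 pl_map_fcomp.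
Qed.

Lemma homeo_mul (g h : thompsonF) x : 0 <= x <= 1 ->
  homeo (g * h)%g x = homeo g (homeo h x).
Proof.
move: g h; elim/fracW=> n t s; elim/fracW=> m t' s' x01.
have [k [p [q e]]] := fcomp_ore s t'.
rewrite (frac_mul _ _ e) -(frac_comp p t) -(frac_comp q t') e.
rewrite !homeo_frac // ?pl_map_comp ?size_widths ?leaves_head ?sum_widths //.
by rewrite -[X in _ <= _ <= X](sum_widths (head Leaf (fcomp q t')))
  pl_map_le ?size_widths ?leaves_head ?sum_widths.
Qed.

Lemma homeo_sigmaF (g : thompsonF) x : 0 <= x <= 1 ->
  homeo (sigmaF g) x = 1 - homeo g (1 - x).
Proof.
move: g; elim/fracW=> n t s x01.
have wm u : widths (mirror u) = rev (widths u).
  by elim: u => //= l -> r ->; rewrite -map_rev rev_cat.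
have hm (u : forest 1 n) : head Leaf (fmirror u) = mirror (head Leaf u).
  by case: u => -[|u [|? ?]].
rewrite sigmaF_frac !homeo_frac ?hm ?wm //; last by apply/andP; split; lra.
by rewrite pl_map_rev ?size_widths ?leaves_head ?sum_widths.
Qed.

End Homeomorphism.

HB.instance Definition _ :=
  isMultiplicative.Build thompsonF thompsonF sigmaF sigmaF_mul.

(** * Commensurability *)

Section Commensurability.
Local Open Scope classical_set_scope.
Local Open Scope group_scope.
Variable G : groupType.
Implicit Types A B : set G.

(* For subgroups: the set of left cosets in [A] of its subgroup [B] is finite. *)
Definition finite_index A B : Prop :=
  finite_set [set [set a * b | b in B] | a in A].

Definition commensurable A B : Prop :=
  finite_index A (A `&` B) /\ finite_index B (A `&` B).

Definition quasi_conjugate A B : Prop :=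
  exists g : G, commensurable A [set g * b * g^-1 | b in B].

End Commensurability.

(** * The Temperley-Lieb-Jones category *)

Section TemperleyLieb.
Variables (K : numClosedFieldType) (delta : K).

(* A point of ['I_m + 'I_n] is a marked point on the bottom ([inl]) or on the
   top ([inr]) of the rectangle, numbered from left to right. This is its
   position along the boundary: bottom from left to right, then top from right
   to left. *)
Definition boundary_pos m n (p : 'I_m + 'I_n) : nat :=
  match p with inl i => i | inr j => m + rev_ord j end%N.

Definition noncrossing_pairing m n (d : {ffun 'I_m + 'I_n -> 'I_m + 'I_n}) :=
  [forall p, (d p != p) && (d (d p) == p)] &&
  [forall p, forall q,
    ~~ [&& (boundary_pos p < boundary_pos q)%N,
           (boundary_pos q < boundary_pos (d p))%N
         & (boundary_pos (d p) < boundary_pos (d q))%N]].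

Record diagram m n := Diagram {
  diagram_fun :> {ffun 'I_m + 'I_n -> 'I_m + 'I_n};
  _ : noncrossing_pairing diagram_fun }.

HB.instance Definition _ m n := [isSub for @diagram_fun m n].
HB.instance Definition _ m n := [Finite of diagram m n by <:].

(* Formal linear combinations of diagrams, before passing to the quotient by
   the kernel of the forms; see [jones_rep] for the quotient. *)
Definition TL m n := {ffun diagram m n -> K^o}.

(* Gluing [e] on top of [d]: the vertices are the bottom, middle and top
   points. *)
Definition lower_pt m n k (p : 'I_m + 'I_n) : 'I_m + 'I_n + 'I_k := inl p.
Definition upper_pt m n k (q : 'I_n + 'I_k) : 'I_m + 'I_n + 'I_k :=
  match q with inl j => inl (inr j) | inr l => inr l end.
Definition outer_pt m n k (r : 'I_m + 'I_k) : 'I_m + 'I_n + 'I_k :=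
  match r with inl i => inl (inl i) | inr l => inr l end.

Definition glue_rel m n k (e : diagram n k) (d : diagram m n) :
    rel ('I_m + 'I_n + 'I_k) := fun x y =>
  [exists p, (x == lower_pt k p) && (y == lower_pt k (d p))] ||
  [exists q, (x == upper_pt m q) && (y == upper_pt m (e q))].

Definition concatenates m n k (e : diagram n k) (d : diagram m n)
    (c : diagram m k) : bool :=
  [forall r, connect (glue_rel e d) (outer_pt n r) (outer_pt n (c r))].

Definition closed_loops m n k (e : diagram n k) (d : diagram m n) : nat :=
  n_comp (glue_rel e d)
    [pred x | [forall r, ~~ connect (glue_rel e d) (outer_pt n r) x]].

Definition tl_comp m n k (y : TL n k) (x : TL m n) : TL m k :=
  [ffun c => \sum_d \sum_(e | concatenates e d c)
     y e * x d * delta ^+ closed_loops e d].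

Definition tl_id n : TL n n :=
  [ffun d : diagram n n => [forall i, d (inl i) == inr i]%:R].

Definition flip_pt m n (p : 'I_m + 'I_n) : 'I_n + 'I_m :=
  match p with inl i => inr i | inr j => inl j end.

Definition tl_dagger m n (x : TL m n) : TL n m :=
  [ffun c : diagram n m =>
     \sum_(d : diagram m n | [forall p, c (flip_pt p) == flip_pt (d p)])
       (x d)^*].

Definition left_pt m1 n1 m2 n2 (p : 'I_m1 + 'I_n1) :
    'I_(m1 + m2) + 'I_(n1 + n2) :=
  match p with inl i => inl (lshift m2 i) | inr j => inr (lshift n2 j) end.
Definition right_pt m1 n1 m2 n2 (p : 'I_m2 + 'I_n2) :
    'I_(m1 + m2) + 'I_(n1 + n2) :=
  match p with inl i => inl (rshift m1 i) | inr j => inr (rshift n1 j) end.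

Definition juxtaposes m1 n1 m2 n2 (d : diagram m1 n1) (e : diagram m2 n2)
    (c : diagram (m1 + m2) (n1 + n2)) : bool :=
  [forall p, c (left_pt m2 n2 p) == left_pt m2 n2 (d p)] &&
  [forall q, c (right_pt m1 n1 q) == right_pt m1 n1 (e q)].

Definition tl_juxt m1 n1 m2 n2 (x : TL m1 n1) (y : TL m2 n2) :
    TL (m1 + m2) (n1 + n2) :=
  [ffun c => \sum_d \sum_(e | juxtaposes d e c) x d * y e].

(* There is exactly one diagram in [diagram 0 2]. *)
Definition tl_cup : TL 0 2 := [ffun=> 1].

(* <x, y> = y^dagger o x, read as a scalar: the identity is the only diagram in
   [diagram 1 1]. *)
Definition tl_form n (x y : TL 1 n) : K :=
  \sum_c tl_comp (tl_dagger y) x c.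

Definition tl_cast m m' n n' (em : m = m') (en : n = n') (x : TL m n) :
    TL m' n' := ecast k (TL m' k) en (ecast k (TL k n) em x).

(** * The forest functor Phi *)

Variables a b : K.

(* The element [R = a R_1 + b R_2] with its bottom right string bent up to the
   top right: bending [R_1] (two vertical strings) gives a string followed by a
   cup, bending [R_2] (a cup above a cap) gives a cup followed by a string. *)
Definition rho : TL 1 3 :=
  a *: tl_juxt (tl_id 1) tl_cup + b *: tl_juxt tl_cup (tl_id 1).

Fact Phi_caret_dom n (k : 'I_n) :
  (k.*2 + 1 + (n - k.+1).*2 = n.*2.-1)%N.
Proof. by have := ltn_ord k; move: (nat_of_ord k) => j; lia. Qed.

Fact Phi_caret_cod n (k : 'I_n) :
  (k.*2 + 3 + (n - k.+1).*2 = n.+1.*2.-1)%N.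
Proof. by have := ltn_ord k; move: (nat_of_ord k) => j; lia. Qed.

Definition Phi_caret n (k : 'I_n) : TL n.*2.-1 n.+1.*2.-1 :=
  tl_cast (Phi_caret_dom k) (Phi_caret_cod k)
    (tl_juxt (tl_juxt (tl_id k.*2) rho) (tl_id (n - k.+1).*2)).

(* [is_Phi f X] means [Phi f = X]: this is the graph of the functor [Phi]. *)
Inductive is_Phi : forall n m, forest n m -> TL n.*2.-1 m.*2.-1 -> Prop :=
| Phi_id n : is_Phi (fid n) (tl_id n.*2.-1)
| Phi_Y n (k : 'I_n) : is_Phi (fcaret k) (Phi_caret k)
| Phi_comp n m k (f : forest m k) (g : forest n m) X Y :
    is_Phi f X -> is_Phi g Y -> is_Phi (fcomp f g) (tl_comp X Y).

(* The span of all [Phi s], for [s] a tree with [n] leaves. *)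
Definition Phi_span n : set (TL 1 n.*2.-1) :=
  [set x | exists N (c : 'I_N -> K) (X : 'I_N -> TL 1 n.*2.-1),
    (forall i, exists s : forest 1 n, is_Phi s (X i)) /\
    x = \sum_i c i *: X i]%classic.

End TemperleyLieb.

(** * Unitary representations *)

Section UnitaryRepresentations.
Variable R : realType.

Record hilbert := Hilbert {
  hilbert_sort :> completeNormedModType R[i];
  hdot : {dot hilbert_sort for Num.conj};
  hdotE : forall x : hilbert_sort, `|x| ^+ 2 = hdot x x }.

Definition unitary (H1 H2 : hilbert) (U : {linear H1 -> H2}) : Prop :=
  (forall x y, hdot H2 (U x) (U y) = hdot H1 x y) /\
  (forall y, exists x, U x = y).

Record unitary_rep (G : groupType) (H : hilbert) := UnitaryRep {
  urep :> G -> {linear H -> H};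
  urep_unitary : forall g, unitary (urep g);
  urep1 : forall x, urep 1%g x = x;
  urepM : forall g h x, urep (g * h)%g x = urep g (urep h x) }.

Definition unitarily_equivalent (G : groupType) (H1 H2 : hilbert)
    (p1 : unitary_rep G H1) (p2 : unitary_rep G H2) : Prop :=
  exists U : {linear H1 -> H2},
    unitary U /\ forall g x, U (p1 g x) = p2 g (U x).

Section Pullback.
Variables (G G' : groupType) (f : {multiplicative G -> G'}) (H : hilbert).
Variable p : unitary_rep G' H.

Fact urep_pullback1 x : p (f 1%g) x = x.
Proof.
have -> : f 1%g = 1%g; last exact: urep1.
by apply: (mulgI (f 1%g)); rewrite -gmulfM !mulg1.
Qed.

Fact urep_pullbackM g h x : p (f (g * h)%g) x = p (f g) (p (f h) x).
Proof. by rewrite gmulfM urepM. Qed.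

Definition urep_pullback : unitary_rep G H :=
  @UnitaryRep G H (fun g => p (f g)) (fun g => urep_unitary p (f g))
    urep_pullback1 urep_pullbackM.

End Pullback.

End UnitaryRepresentations.

(** * The Jones representations *)

Section JonesRepresentation.
Local Open Scope classical_set_scope.
Variables (R : realType) (delta a b : R[i]).

(* The Jones representation on the completion of the inductive limit, given by
   its universal property, which determines it up to a unique unitary
   equivalence. [jr_in t x] is the class of [(t, x)]. Since [hdot] is definite
   and [jr_in t] is isometric, [jr_in t] identifies exactly the elements which
   differ by an element of the kernel of [tl_form]. *)
Record jones_rep := JonesRep {
  jr_space : hilbert R;
  jr_in : forall n, forest 1 n -> TL R[i] 1 n.*2.-1 -> jr_space;
  jr_in_linear : forall n (t : forest 1 n) (c : R[i]) x y,
    Phi_span delta a b x -> Phi_span delta a b y ->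
    jr_in t (c *: x + y) = c *: jr_in t x + jr_in t y;
  jr_in_isometry : forall n (t : forest 1 n) x y,
    Phi_span delta a b x -> Phi_span delta a b y ->
    hdot jr_space (jr_in t x) (jr_in t y) = tl_form delta x y;
  jr_in_limit : forall n m (t : forest 1 n) (f : forest n m) X x,
    is_Phi delta a b f X -> Phi_span delta a b x ->
    jr_in (fcomp f t) (tl_comp delta X x) = jr_in t x;
  jr_in_dense : dense
    [set v | exists n (t : forest 1 n) x,
       Phi_span delta a b x /\ v = jr_in t x];
  jr_rep : unitary_rep thompsonF jr_space;
  jr_repE : forall n m k (t s : forest 1 n) (v : forest 1 m)
      (p : forest n k) (q : forest m k) X x,
    fcomp p s = fcomp q v -> is_Phi delta a b q X -> Phi_span delta a b x ->
    jr_rep (frac t s) (jr_in v x) = jr_in (fcomp p t) (tl_comp delta X x) }.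

Definition jr_vacuum (J : jones_rep) : jr_space J :=
  jr_in J (fid 1) (tl_id R[i] 1).

Definition vacuum_stabilizer (J : jones_rep) : set thompsonF :=
  [set g | jr_rep J g (jr_vacuum J) = jr_vacuum J].

End JonesRepresentation.

(* Main.v *)
Require Import Defs.
From mathcomp Require Import all_boot all_order all_algebra complex.
From mathcomp Require Import zify ring.
From mathcomp Require Import all_classical all_reals all_analysis.

(**
The coefficient of [pi (t/s)] at the vacuum is the Gram form
[tl_form (Phi s) (Phi t)]. For [delta = sqrt 2] it can be computed by colouring
every other region (starting with the leftmost) with two colours: [rho] sends a
region of colour [c] to the pair [(c, ~~ c)], so [Phi t] becomes a single
colouring, in which each leaf of [t] carries the parity of the number of right
turns on the path to it. Hence the coefficient is 1 if the parity sequences of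
[t] and [s] agree and 0 otherwise.

Reflection replaces right turns by left turns. The trees [tree_p] and [tree_q]
have the same left parities and different right parities. Given
[h = t/s] with [n] leaves, let [b_i], for [i < n], be the quotient of [t] with a
[tree_p] on every leaf by [t] with a [tree_p] on every leaf except a [tree_q] on
the [i]-th. Then [b_i] lies in [sigma_F (vec F)], while [(b_i h)^-1 (b_j h)] is
not in [vec F] for [i <> j]. As [n] is arbitrarily large, no conjugate of
[vec F] meets [sigma_F (vec F)] in a subgroup of finite index. If [U] intertwined
the two representations, [U Omega] would be fixed by [sigma_F (vec F)] and have
the same nonzero coefficient on the orthonormal vectors [pi (b_i h) Omega],
contradicting Bessel's inequality.
*)

Set Implicit Arguments.
Unset Strict Implicit.
Unset Printing Implicit Defensive.

Import Order.TTheory GRing.Theory Num.Theory numFieldNormedType.Exports.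

Local Notation frac := Defs.frac.

(** * Non-crossing matchings *)

(** The increasing enumeration of the points other than [j] and [j.+1]. Matchings are functions on
    plain natural numbers, so that [lia] can settle the index arithmetic. *)
Definition skip2 j i := if i < j then i else i.+2.
Definition unskip2 j i := if i < j then i else i.-2.

Lemma skip2K j : cancel (skip2 j) (unskip2 j).
Proof. by move=> i; rewrite /skip2 /unskip2; do 3?case: ifP; lia. Qed.

Lemma unskip2K j i : i != j -> i != j.+1 -> skip2 j (unskip2 j i) = i.
Proof. by rewrite /skip2 /unskip2; do 2?case: ifP; lia. Qed.

Lemma skip2_neq j i : (skip2 j i != j) && (skip2 j i != j.+1).
Proof. by rewrite /skip2; case: ifP; lia. Qed.

Lemma ltn_skip2 j N i : i < N -> skip2 j i < N.+2.
Proof. by rewrite /skip2; case: ifP; lia. Qed.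

Lemma ltn_unskip2 j N i : j <= N -> i < N.+2 -> i != j -> i != j.+1 ->
  unskip2 j i < N.
Proof. by rewrite /unskip2; case: ifP; lia. Qed.

Definition ins_pair j (d : nat -> nat) u :=
  if u == j then j.+1 else if u == j.+1 then j else skip2 j (d (unskip2 j u)).

(** The effect of a cap on the points [j] and [j.+1]: a strand ending at one of them continues along
    the strand ending at the other. If [e] joins these two points, the loop so closed is dropped. *)
Definition cap_pair j (e : nat -> nat) u :=
  let v := e (skip2 j u) in
  unskip2 j (if v == j then e j.+1 else if v == j.+1 then e j else v).

Record matching N (e : nat -> nat) : Prop := Matching {
  matching_lt : forall u, u < N -> e u < N;
  matchingK : forall u, u < N -> e (e u) = u;
  matching_neq : forall u, u < N -> e u != u;
  matching_nc : forall u v, u < N -> v < N ->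
    ~~ [&& u < v, v < e u & e u < e v] }.

Lemma ins_pair_l j d : ins_pair j d j = j.+1.
Proof. by rewrite /ins_pair eqxx. Qed.

Lemma ins_pair_r j d : ins_pair j d j.+1 = j.
Proof. by rewrite /ins_pair eqxx ifF //; lia. Qed.

Lemma ins_pair_skip2 j d i : ins_pair j d (skip2 j i) = skip2 j (d i).
Proof.
by have /andP[/negPf h1 /negPf h2] := skip2_neq j i; rewrite /ins_pair h1 h2 skip2K.
Qed.

Variant skip2_spec j N : nat -> Prop :=
| Skip2Left : skip2_spec j N j
| Skip2Right : skip2_spec j N j.+1
| Skip2Other i of i < N : skip2_spec j N (skip2 j i).

Lemma skip2P j N u : j <= N -> u < N.+2 -> skip2_spec j N u.
Proof.
move=> jN uN; have [->|nj] := eqVneq u j; first by constructor.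
have [->|nj'] := eqVneq u j.+1; first by constructor.
by rewrite -(unskip2K nj nj'); constructor; apply: ltn_unskip2.
Qed.

Lemma matching_ins N j d :
  j <= N -> matching N d -> matching N.+2 (ins_pair j d).
Proof.
move=> jN [dlt dK dneq dnc]; split.
- move=> u /(skip2P jN)[]; rewrite ?ins_pair_l ?ins_pair_r; try lia.
  by move=> i iN; rewrite ins_pair_skip2 ltn_skip2 // dlt.
- move=> u /(skip2P jN)[]; rewrite ?(ins_pair_l, ins_pair_r) //.
  by move=> i iN; rewrite !ins_pair_skip2 dK.
- move=> u /(skip2P jN)[]; rewrite ?ins_pair_l ?ins_pair_r; try lia.
  move=> i iN; rewrite ins_pair_skip2; move: (dneq i iN).
  by rewrite /skip2; do 2?case: ifP; lia.
- move=> u v /(skip2P jN) su /(skip2P jN) sv.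
  case: su => [||i iN]; case: sv => [||i' iN'];
    rewrite ?ins_pair_l ?ins_pair_r ?ins_pair_skip2 /skip2;
    try by do ?case: ifP; lia.
  by have := dnc i i' iN iN'; do ?case: ifP; lia.
Qed.

Definition matching_base u := 1 - u.

Lemma matching_base1 : matching 2 matching_base.
Proof. by split; rewrite /matching_base; lia. Qed.

(* The head of a word is the position of the last pair inserted. *)
Definition word_matching (w : seq nat) := foldr ins_pair matching_base w.

(** The bound keeps the last point, which stands for the bottom end of a diagram, out of every
    inserted pair. *)
Fixpoint valid_word (w : seq nat) :=
  if w is i :: w' then (i < (size w).*2) && valid_word w' else true.

Lemma matching_word w :
  valid_word w -> matching (size w).+1.*2 (word_matching w).
Proof.
elim: w => [_|i w IH /= /andP[hi /IH hw]]; first exact: matching_base1.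
by rewrite doubleS; apply: matching_ins => //; lia.
Qed.

(* Caps a word at [j] and [j.+1] (see [cap_word_matching]); the first component
   counts the closed loop created. The last case is a junk value. *)
Fixpoint cap_word j (w : seq nat) : nat * seq nat :=
  if w is i :: w' then
    if i == j then (1, w')
    else if (i == j.+1) || (i.+1 == j) then (0, w')
    else if i < j then let: (eps, v) := cap_word j.-2 w' in (eps, i :: v)
    else let: (eps, v) := cap_word j w' in (eps, i.-2 :: v)
  else (0, [::]).

(** The relative positions of the cap at [j] and the last cup, at [i]: equal positions close a loop,
    one common point gives a zigzag to be straightened, and otherwise cap and cup slide past each
    other. Additive equations replace the truncated subtractions. *)
Variant cap_word_cons_spec j i w : nat * seq nat -> Prop :=
| CapWordSame of i = j : cap_word_cons_spec j i w (1, w)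
| CapWordNext of i = j.+1 : cap_word_cons_spec j i w (0, w)
| CapWordPrev of i.+1 = j : cap_word_cons_spec j i w (0, w)
| CapWordLt j' of j = j'.+2 & i < j'.+1 :
    cap_word_cons_spec j i w ((cap_word j' w).1, i :: (cap_word j' w).2)
| CapWordGt i' of i = i'.+2 & j < i'.+1 :
    cap_word_cons_spec j i w ((cap_word j w).1, i' :: (cap_word j w).2).

Lemma cap_word_consP j i w : cap_word_cons_spec j i w (cap_word j (i :: w)).
Proof.
rewrite /=; case: eqVneq => [|n1]; first by constructor.
case: eqVneq => [|n2]; first by constructor.
case: eqVneq => [|n3]; first by constructor.
case: ltnP => h /=.
  case: j n1 n2 n3 h => [|[|j]] n1 n2 n3 h //=; [lia|].
  by have := @CapWordLt j.+2 i w j erefl; case: (cap_word j w) => e v; apply; lia.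
case: i n1 n2 n3 h => [|[|i]] n1 n2 n3 h //=; [lia|lia|].
by have := @CapWordGt j i.+2 w i erefl; case: (cap_word j w) => e v; apply; lia.
Qed.

Lemma cap_word_valid j w : valid_word w -> j < (size w).*2 ->
  valid_word (cap_word j w).2 /\ (size (cap_word j w).2).+1 = size w.
Proof.
elim: w j => [|i w IH] j //; rewrite [valid_word _]/= [size _]/=.
move=> /andP[hi hw] hj; rewrite /= in hj.
case: cap_word_consP => [||| j' ej hlt | i' ei hlt];
  rewrite ?hw //=; subst.
  by have [|-> h2] := IH j' hw; [lia | rewrite andbT; split; lia].
by have [|-> h2] := IH j hw; [lia | rewrite andbT; split; lia].
Qed.

(** * Temperley-Lieb relations between a cap and a cup *)

Section CapInsert.
Variables (N : nat) (e : nat -> nat).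
Hypothesis me : matching N e.

Lemma cap_ins_same j u : cap_pair j (ins_pair j e) u = e u.
Proof.
have /andP[/negPf h1 /negPf h2] := skip2_neq j (e u).
by rewrite /cap_pair ins_pair_skip2 h1 h2 skip2K.
Qed.

Lemma cap_ins_next j u : u < N -> cap_pair j (ins_pair j.+1 e) u = e u.
Proof.
move=> uN; rewrite /cap_pair; have := matching_neq me uN.
have [->|nu] := eqVneq u j.
  have -> : skip2 j j = j.+2 by rewrite /skip2 ltnn.
  rewrite ins_pair_r eqxx ifF; last by lia.
  have := ins_pair_skip2 j.+1 e j; rewrite {1}/skip2 ltnSn => ->.
  by rewrite /unskip2 /skip2; do 2?case: ifP; lia.
have -> : skip2 j u = skip2 j.+1 u by rewrite /skip2; do 2?case: ifP; lia.
rewrite ins_pair_skip2 ins_pair_l /unskip2 /skip2.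
by do 5?case: ifP; lia.
Qed.

Lemma cap_ins_prev j u : u < N -> cap_pair j.+1 (ins_pair j e) u = e u.
Proof.
move=> uN; rewrite /cap_pair; have := matching_neq me uN.
have [->|nu] := eqVneq u j.
  have -> : skip2 j.+1 j = j by rewrite /skip2 ltnSn.
  rewrite ins_pair_l eqxx.
  have := ins_pair_skip2 j e j; rewrite {1}/skip2 ltnn => ->.
  by rewrite /unskip2 /skip2; do 2?case: ifP; lia.
have -> : skip2 j.+1 u = skip2 j u by rewrite /skip2; do 2?case: ifP; lia.
rewrite ins_pair_skip2 ins_pair_r /unskip2 /skip2.
by do 5?case: ifP; lia.
Qed.

(** Far commutation: the cap lies to the right of the cup, so its position drops by 2 once it acts
    before the cup is inserted. *)
Lemma cap_ins_lt i j u : i < j.+1 -> j.+1 < N -> u < N ->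
  cap_pair j.+2 (ins_pair i e) u = ins_pair i (cap_pair j e) u.
Proof.
move=> ij jN uN.
have ltj u' : u' < i.+2 -> skip2 j.+2 u' = u' by rewrite /skip2; case: ifP; lia.
have skC u' : skip2 j.+2 (skip2 i u') = skip2 i (skip2 j u').
  by rewrite /skip2; do 4?case: ifP; lia.
have uskC u' : u' != j -> u' != j.+1 ->
    unskip2 j.+2 (skip2 i u') = skip2 i (unskip2 j u').
  by rewrite /skip2 /unskip2; do 4?case: ifP; lia.
have eqj u' : (skip2 i u' == j.+2) = (u' == j) by rewrite /skip2; case: ifP; lia.
have eqj' u' : (skip2 i u' == j.+3) = (u' == j.+1).
  by rewrite /skip2; case: ifP; lia.
have skj : skip2 i j = j.+2 by rewrite /skip2 ifF //; lia.
have skj' : skip2 i j.+1 = j.+3 by rewrite /skip2 ifF //; lia.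
have /skip2P : i <= N.-2 by lia.
move=> /(_ u); rewrite (_ : N.-2.+2 = N); last by lia.
case=> //; rewrite ?ins_pair_l ?ins_pair_r ?ins_pair_skip2 /cap_pair ?skC.
- rewrite ltj; last by lia.
  by rewrite ins_pair_l !ifF /unskip2; try case: ifP; lia.
- rewrite ltj; last by lia.
  by rewrite ins_pair_r !ifF /unskip2; try case: ifP; lia.
move=> u' u'N; set x := skip2 j u'.
have xN : x < N by rewrite /x /skip2; case: ifP; lia.
have eN := matchingK me; have ne := matching_neq me.
have /andP[xj xj'] : (x != j) && (x != j.+1) := skip2_neq j u'.
have e1 : ins_pair i e j.+2 = skip2 i (e j) by rewrite -skj ins_pair_skip2.
have e2 : ins_pair i e j.+3 = skip2 i (e j.+1) by rewrite -skj' ins_pair_skip2.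
rewrite skC !ins_pair_skip2 -/x eqj eqj' e1 e2.
(* [uskC] needs the continued strand to end off the cap: if [e] joined [j] and [j.+1], involutivity
   would force [x] to be one of them. *)
case: eqVneq => [exj | nexj].
  rewrite uskC //; last exact: ne.
  by apply: contraNneq xj' => E; rewrite -(eN x) // exj -[X in e X]E eN.
case: eqVneq => [exj' | nexj']; last by rewrite uskC.
have jN' : j < N by lia.
rewrite uskC //; first exact: ne.
by apply: contraNneq xj => E; rewrite -(eN x) // exj' -[X in e X]E eN.
Qed.

Lemma cap_ins_gt i j u : j < i.+1 -> i.+1 < N -> u < N ->
  cap_pair j (ins_pair i.+2 e) u = ins_pair i (cap_pair j e) u.
Proof.
move=> ji iN uN.
have gej u' : i <= u' -> skip2 j u' = u'.+2 by rewrite /skip2; case: ifP; lia.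
have skC u' : skip2 j (skip2 i u') = skip2 i.+2 (skip2 j u').
  by rewrite /skip2; do 4?case: ifP; lia.
have uskC u' : u' != j -> u' != j.+1 ->
    unskip2 j (skip2 i.+2 u') = skip2 i (unskip2 j u').
  by rewrite /skip2 /unskip2; do 4?case: ifP; lia.
have eqj u' : (skip2 i.+2 u' == j) = (u' == j) by rewrite /skip2; case: ifP; lia.
have eqj' u' : (skip2 i.+2 u' == j.+1) = (u' == j.+1).
  by rewrite /skip2; case: ifP; lia.
have skj : skip2 i.+2 j = j by rewrite /skip2 ifT //; lia.
have skj' : skip2 i.+2 j.+1 = j.+1 by rewrite /skip2 ifT //; lia.
have /skip2P : i <= N.-2 by lia.
move=> /(_ u); rewrite (_ : N.-2.+2 = N); last by lia.
case=> //; rewrite ?ins_pair_l ?ins_pair_r ?ins_pair_skip2 /cap_pair ?skC.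
- rewrite gej; last by lia.
  by rewrite ins_pair_l !ifF /unskip2; try case: ifP; lia.
- rewrite gej; last by lia.
  by rewrite ins_pair_r !ifF /unskip2; try case: ifP; lia.
move=> u' u'N; set x := skip2 j u'.
have xN : x < N by rewrite /x /skip2; case: ifP; lia.
have eN := matchingK me; have ne := matching_neq me.
have /andP[xj xj'] : (x != j) && (x != j.+1) := skip2_neq j u'.
have e1 : ins_pair i.+2 e j = skip2 i.+2 (e j) by rewrite -{1}skj ins_pair_skip2.
have e2 : ins_pair i.+2 e j.+1 = skip2 i.+2 (e j.+1).
  by rewrite -{1}skj' ins_pair_skip2.
have jN : j.+1 < N by lia.
rewrite skC !ins_pair_skip2 -/x eqj eqj' e1 e2.
case: eqVneq => [exj | nexj].
  rewrite uskC //; last exact: ne.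
  by apply: contraNneq xj' => E; rewrite -(eN x) // exj -[X in e X]E eN.
case: eqVneq => [exj' | nexj']; last by rewrite uskC.
have jN' : j < N by lia.
rewrite uskC //; first exact: ne.
by apply: contraNneq xj => E; rewrite -(eN x) // exj' -[X in e X]E eN.
Qed.

End CapInsert.

(** Induction on the word: by the relations above, the cap slides past the cups until it meets one
    with which it cancels. *)
Lemma cap_word_matching j w u : valid_word w -> j < (size w).*2 ->
  u < (size w).*2 ->
  word_matching (cap_word j w).2 u = cap_pair j (word_matching w) u.
Proof.
elim: w j u => [|i w IH] j u //; rewrite [valid_word _]/= [size _]/=.
move=> /andP[hi hw] hj uw; rewrite /= in hj uw; have mw := matching_word hw.
case: cap_word_consP => [->|->|<-| j' ej hlt | i' ei hlt]; rewrite [_.2]/=.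
- by rewrite -/(word_matching _) cap_ins_same.
- by rewrite [word_matching (_ :: _)]/= (cap_ins_next mw).
- by rewrite [word_matching (_ :: _)]/= (cap_ins_prev mw).
- subst; rewrite [word_matching (_ :: w)]/= (cap_ins_lt mw) //; last by lia.
  rewrite [word_matching (_ :: _)]/= .
  have hs : i <= (size w).*2 by lia.
  case: (skip2P hs uw).
  + by rewrite !ins_pair_l.
  + by rewrite !ins_pair_r.
  + by move=> v vw; rewrite !ins_pair_skip2 -IH //; lia.
subst; rewrite [word_matching (_ :: w)]/= (cap_ins_gt mw) //; last by lia.
rewrite [word_matching (_ :: _)]/= .
have hs : i' <= (size w).*2 by lia.
case: (skip2P hs uw).
+ by rewrite !ins_pair_l.
+ by rewrite !ins_pair_r.
+ by move=> v vw; rewrite !ins_pair_skip2 -IH //; lia.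
Qed.

Lemma cap_word_fst j w : valid_word w -> j < (size w).*2 ->
  (cap_word j w).1 = (word_matching w j == j.+1) :> nat.
Proof.
elim: w j => [|i w IH] j //; rewrite [valid_word _]/= [size _]/=.
move=> /andP[hi hw] hj; rewrite /= in hj; have mw := matching_word hw.
case: cap_word_consP => [->|->|<-| j' ej hlt | i' ei hlt];
  rewrite [_.1]/= ?[word_matching (_ :: _)]/=; subst.
- by rewrite ins_pair_l eqxx.
- rewrite (_ : ins_pair _ _ _ = skip2 j.+1 (word_matching w j)).
    by rewrite /skip2; case: ifP => h; case: eqP; lia.
  by rewrite -ins_pair_skip2 /skip2 ltnSn.
- by rewrite ins_pair_r; case: eqP; lia.
- rewrite IH //.
  rewrite (_ : ins_pair _ _ _ = skip2 i (word_matching w j')).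
    by congr nat_of_bool; rewrite /skip2; case: ifP; lia.
  by rewrite -ins_pair_skip2 /skip2 ifF //; lia.
rewrite IH //; last by lia.
rewrite (_ : ins_pair _ _ _ = skip2 i'.+2 (word_matching w j)).
  by congr nat_of_bool; rewrite /skip2; case: ifP; lia.
by rewrite -ins_pair_skip2 /skip2 ifT //; lia.
Qed.

(** * Counting the loops of two glued matchings *)

Definition loop_rel N (d e : nat -> nat) : rel 'I_N :=
  fun x y => (y == d x :> nat) || (y == e x :> nat).

Definition loops N d e := n_comp (@loop_rel N d e) predT.

Lemma loop_rel_sym N d e : matching N d -> matching N e ->
  symmetric (@loop_rel N d e).
Proof.
move=> md me x y; rewrite /loop_rel; apply/idP/idP; case/orP=> /eqP ->;
  by rewrite ?(matchingK md) ?(matchingK me) // eqxx ?orbT.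
Qed.

Lemma skip2_cap N j e i : matching N.+2 e -> j <= N -> i < N ->
  skip2 j (cap_pair j e i) = if e (skip2 j i) == j then e j.+1
   else if e (skip2 j i) == j.+1 then e j else e (skip2 j i).
Proof.
move=> me jN iN; rewrite /cap_pair /=; set x := skip2 j i.
have /andP[xj xj'] : (x != j) && (x != j.+1) := skip2_neq j i.
have xN : x < N.+2 by apply: ltn_skip2.
have eN := matchingK me; have ne := matching_neq me.
have jN2 : j < N.+2 by lia.
case: eqVneq => [exj | nexj].
  rewrite unskip2K //; last exact: ne.
  by apply: contraNneq xj' => E; rewrite -(eN x) // exj -[X in e X]E eN.
case: eqVneq => [exj' | nexj']; last by rewrite unskip2K.
rewrite unskip2K //; first exact: ne.
by apply: contraNneq xj => E; rewrite -(eN x) // exj' -[X in e X]E eN.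
Qed.

Lemma cap_pairK N j e i : matching N.+2 e -> j <= N -> i < N ->
  cap_pair j e (cap_pair j e i) = i.
Proof.
move=> me jN iN; have sk := skip2_cap me jN iN.
have eN := matchingK me; have xN : skip2 j i < N.+2 by apply: ltn_skip2.
have /andP[xj xj'] := skip2_neq j i.
rewrite -[RHS](skip2K j) {1}/cap_pair sk; congr (unskip2 j).
have jN2 : j < N.+2 by lia.
have jN3 : j.+1 < N.+2 by lia.
case: (eqVneq (e (skip2 j i)) j) => [E|n1].
  by rewrite eN // (gtn_eqF (ltnSn j)) eqxx -[X in e X]E eN.
case: (eqVneq (e (skip2 j i)) j.+1) => [E|n2].
  by rewrite eN // eqxx -[X in e X]E eN.
by rewrite eN // (negPf xj) (negPf xj').
Qed.

(** Cups and caps are adjoint: the cup added to [d] can be moved over to [e], where it acts as a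
    cap. Its two points leave the graph, and a component is lost only if they form one by
    themselves, that is, if [e] joins them too. *)
Lemma loops_ins N d e j : matching N d -> matching N.+2 e -> j <= N ->
  loops N.+2 (ins_pair j d) e = (e j == j.+1) + loops N d (cap_pair j e).
Proof.
move=> md me jN; set R := @loop_rel N.+2 (ins_pair j d) e.
set R' := @loop_rel N d (cap_pair j e).
have mi := matching_ins jN md.
have symR : connect_sym R by apply/sym_connect_sym/loop_rel_sym.
have symR' : connect_sym R'.
  apply/sym_connect_sym => x y; rewrite /R' /loop_rel.
  by apply/idP/idP; case/orP=> /eqP ->;
    rewrite ?(matchingK md) ?(cap_pairK me) // eqxx ?orbT.
have jN2 : j < N.+2 by lia.
have jN3 : j.+1 < N.+2 by lia.
pose J := Ordinal jN2; pose J' := Ordinal jN3.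
(* The vertices to keep: all of them, or all but the loop through [J] and [J'] if [e] joins these.
   That loop is counted by the summand [e j == j.+1]. *)
pose a := [pred u : 'I_N.+2 | (e j != j.+1) || ((u != J) && (u != J'))].
have eN := matchingK me; have ne := matching_neq me.
have RJ : R J J' by rewrite /R /loop_rel /= ins_pair_l eqxx.
have cla : fingraph.closed R a.
  apply: intro_closed => // x y.
  rewrite /R /loop_rel /a !inE -!(inj_eq val_inj) /=.
  case: (eqVneq (e j) j.+1) => //= ej.
  have ej' : e j.+1 = j by rewrite -ej eN.
  case/orP => /eqP-> /andP[xj xj'].
    rewrite -(unskip2K xj xj') ins_pair_skip2.
    exact: skip2_neq.
  apply/andP; split; apply/eqP => E.
    by move: xj'; rewrite -ej -E eN ?eqxx.
  by move: xj; rewrite -ej' -E eN ?eqxx.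
rewrite /loops (n_compC a) -/R -/R' [LHS]addnC; congr addn.
  case: (eqVneq (e j) j.+1) => ej /=; last first.
    by apply: eq_card0 => u; rewrite /a !inE ej andbF.
  rewrite -(n_comp_connect symR J); apply: eq_n_comp_r => u.
  rewrite /a !inE ej eqxx /= negb_and !negbK.
  apply/idP/idP.
    by case/orP=> /eqP->; [exact: connect0 | exact: connect1].
  have := closed_connect cla; move=> /[apply].
  rewrite /a !inE ej eqxx /= !eqxx /=.
  by move=> /esym/negbT; rewrite negb_and !negbK.
(* [phi] moves [j] and [j.+1] along their strands of [e] to surviving points. Up to connectedness it
   is inverse to the inclusion [h] defined below, so the components of the two graphs correspond. *)
pose phi u := if u == j then unskip2 j (e j) else
  if u == j.+1 then unskip2 j (e j.+1) else unskip2 j u.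
have phi_lt (u : 'I_N.+2) : u \in a -> phi u < N.
  rewrite /phi /a !inE -!(inj_eq val_inj) /=.
  have := ltn_ord u; move: (nat_of_ord u) => v vN.
  have lt := matching_lt me.
  case: (eqVneq v j) => [->|vj].
    rewrite orbF => ej; apply: ltn_unskip2 => //; [exact: lt|exact: ne].
  case: (eqVneq v j.+1) => [_|vj' _]; last exact: ltn_unskip2.
  rewrite orbF => ej; apply: ltn_unskip2 => //; [exact: lt| |exact: ne].
  by apply: contraNneq ej => E; rewrite -[X in e X]E eN.
pose h (i : 'I_N) : 'I_N.+2 := Ordinal (ltn_skip2 j (ltn_ord i)).
have ha i : h i \in a.
  by rewrite /a !inE -!(inj_eq val_inj) /= skip2_neq orbT.
rewrite (@adjunction_n_comp _ _ h R R' symR symR' a cla).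
  by apply: eq_n_comp_r => i; rewrite inE ha.
have cE (T : finType) (S : rel T) x y : x = y -> connect S x y.
  by move=> ->; apply: connect0.
have phi_skip i : phi (skip2 j i) = i.
  by have /andP[/negPf s1 /negPf s2] := skip2_neq j i; rewrite /phi s1 s2 skip2K.
have phij : phi j = unskip2 j (e j) by rewrite /phi eqxx.
have phij' : phi j.+1 = unskip2 j (e j.+1).
  by rewrite /phi (gtn_eqF (ltnSn j)) eqxx.
have aj (u : 'I_N.+2) : u \in a -> (u == J) || (u == J') -> e j != j.+1.
  by rewrite /a !inE; case: (e j == j.+1) => //= /andP[/negPf-> /negPf->].
have ej' : e j != j.+1 -> e j.+1 != j.
  by apply: contraNneq => E; rewrite -[X in e X]E eN.
have skej : e j != j.+1 -> skip2 j (unskip2 j (e j)) = e j.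
  by move=> ?; rewrite unskip2K // ne.
have skej' : e j != j.+1 -> skip2 j (unskip2 j (e j.+1)) = e j.+1.
  by move=> ?; rewrite unskip2K ?ej' // ne.
refine (@intro_adjunction _ _ h R R' symR' a cla
  (fun u ua => Ordinal (phi_lt u ua)) _ _).
  move=> x xa; split.
    have [xJ|xJ] := boolP ((x == J) || (x == J')).
      have nej := aj x xa xJ; apply: connect1; apply/orP; right; apply/eqP => /=.
      by case/orP: xJ => /eqP->; rewrite /= ?phij ?phij' ?skej ?skej'.
    apply: cE; apply: val_inj => /=; move: xJ; rewrite negb_or => /andP[].
    rewrite -!(inj_eq val_inj) /= => xj xj'.
    by rewrite -{2}(unskip2K xj xj') phi_skip unskip2K.
  move=> y ya Rxy.
  have [xJ|xJ] := boolP ((x == J) || (x == J')).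
    have nej := aj x xa xJ; case/orP: Rxy => /eqP yE.
      apply: connect1; apply/orP; right; apply/eqP => /=; rewrite yE.
      case/orP: xJ => /eqP-> /=;
        rewrite ?ins_pair_l ?ins_pair_r phij phij' /cap_pair.
        by rewrite skej // eN // eqxx.
      by rewrite skej' // eN // eqxx (gtn_eqF (ltnSn j)).
    apply: cE; apply: val_inj => /=; rewrite yE.
    case/orP: xJ => /eqP-> /=; rewrite ?phij ?phij'.
      by rewrite -{2}(skej nej) phi_skip.
    by rewrite -{2}(skej' nej) phi_skip.
  move: xJ; rewrite negb_or => /andP[].
  rewrite -!(inj_eq val_inj) /= => xj xj'.
  case/orP: Rxy => /eqP yE.
    apply: connect1; apply/orP; left; apply/eqP => /=; rewrite yE.
    by rewrite -(unskip2K xj xj') ins_pair_skip2 !phi_skip.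
  have [eyj|eyj] := eqVneq (nat_of_ord y) j.
    have ej : e j = x by rewrite -[X in e X]eyj yE eN.
    apply: cE; apply: val_inj => /=; rewrite eyj phij ej.
    by rewrite -{1}(unskip2K xj xj') phi_skip.
  have [eyj'|eyj'] := eqVneq (nat_of_ord y) j.+1.
    have ej : e j.+1 = x by rewrite -[X in e X]eyj' yE eN.
    apply: cE; apply: val_inj => /=; rewrite eyj' phij' ej.
    by rewrite -{1}(unskip2K xj xj') phi_skip.
  apply: connect1; apply/orP; right; apply/eqP => /=.
  rewrite -{1}(unskip2K eyj eyj') phi_skip -{1}(unskip2K xj xj') phi_skip.
  by rewrite /cap_pair unskip2K // -yE (negPf eyj) (negPf eyj').
move=> x xa; split; first by apply: cE; apply: val_inj; rewrite /= phi_skip.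
move=> y /orP[]/eqP yE.
  by apply: connect1; apply/orP; left; apply/eqP; rewrite /= yE ins_pair_skip2.
have := skip2_cap me jN (ltn_ord x); rewrite -yE.
have -> : skip2 j y = h y by [].
have -> : skip2 j x = h x by [].
(* An arc of the capped matching that runs through the cap lifts to a path through the cup between
   [J] and [J']. *)
case: eqVneq => [E1 E2|_].
  apply: (@connect_trans _ _ J); first by apply/connect1/orP; right; rewrite E1.
  apply: (@connect_trans _ _ J'); first exact: connect1.
  by apply/connect1/orP; right; rewrite E2.
case: eqVneq => [E1 E2|_ E2].
  apply: (@connect_trans _ _ J'); first by apply/connect1/orP; right; rewrite E1.
  apply: (@connect_trans _ _ J); first by rewrite symR; exact: connect1.
  by apply/connect1/orP; right; rewrite E2.
by apply/connect1/orP; right; rewrite E2.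
Qed.

Lemma eq_loops N d e e' : (forall i, i < N -> e i = e' i) ->
  loops N d e = loops N d e'.
Proof.
move=> h; apply: eq_n_comp; apply: eq_connect => x y.
by rewrite /loop_rel h.
Qed.

(** * Colourings of the shaded regions and the evaluation of words on them *)

Definition add_color k b (c : nat -> bool) i :=
  if i <= k then c i else if i == k.+1 then b else c i.-1.

Definition del_color k (c : nat -> bool) i := if i <= k then c i else c i.+1.

Ltac color_lia := rewrite /del_color /add_color; repeat case: ifP; intros;
  first [by [] | exfalso; lia | congr (_ _); lia].

Fixpoint valid_carets (ks : seq nat) :=
  if ks is k :: ks' then (k <= size ks') && valid_carets ks' else true.

(** A caret at the leaf [k] keeps the colour of this leaf on its left branch and flips it on its
    right branch. The colours are therefore the parities of right turns (see
    [nth_right_parity_caret]). *)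
Fixpoint caret_color (ks : seq nat) : nat -> bool :=
  if ks is k :: ks' then add_color k (~~ caret_color ks' k) (caret_color ks')
  else fun=> false.

Lemma loops_base : loops 2 matching_base matching_base = 1.
Proof.
set R := @loop_rel 2 matching_base matching_base.
have symR : connect_sym R.
  by apply/sym_connect_sym/loop_rel_sym; apply: matching_base1.
rewrite /loops -/R; apply: etrans (n_comp_connect symR ord0).
apply: eq_n_comp_r => x.
rewrite !inE; apply/esym; case: x => -[|[|x]] hx //.
  by rewrite (_ : Ordinal hx = ord0) ?connect0 //; apply: val_inj.
exact: connect1.
Qed.

Section Evaluation.
Local Open Scope ring_scope.
Variables (K : fieldType) (delta a b : K).

(* The shaded region between the points [2 k - 1] and [2 k] has colour [c k]. A cup
   has weight the square root of the ratio of the Perron-Frobenius weights (for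
   the graph A_3) inside and outside of it: [a^-1] if its inside is shaded, and
   [a] otherwise, when it joins two shaded regions. *)
Fixpoint color_eval (w : seq nat) (c : nat -> bool) : K :=
  if w is i :: w' then
    (if odd i then a^-1 else a * (c i./2 == c i./2.+1)%:R) *
    color_eval w' (del_color i./2 c)
  else delta.

Lemma eq_color_eval w c c' : c =1 c' -> color_eval w c = color_eval w c'.
Proof.
elim: w c c' => //= i w IH c c' E; rewrite !E; congr (_ * _).
by apply: IH => x; rewrite /del_color !E.
Qed.

(* The expansion of [Phi] on the tree built by adding carets at the leaves [ks],
   the last one first. *)
Fixpoint caret_terms (ks : seq nat) : seq (K * seq nat) :=
  if ks is k :: ks' then
    [seq (a * t.1, k.*2.+1 :: t.2) | t <- caret_terms ks'] ++
    [seq (b * t.1, k.*2 :: t.2) | t <- caret_terms ks']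
  else [:: (1, [::])].

Lemma caret_terms_valid ks t : valid_carets ks -> t \in caret_terms ks ->
  valid_word t.2 /\ size t.2 = size ks.
Proof.
elim: ks t => [|k ks IH] t /=; first by rewrite inE => _ /eqP->.
move=> /andP[hk hks]; rewrite mem_cat => /orP[] /mapP[u /(IH _ hks)[hu su] ->] /=;
  by rewrite su hu andbT; split; lia.
Qed.

Hypotheses (a_neq0 : a != 0) (a2 : a ^+ 2 = delta) (ab : a * b = -1)
  (delta2 : delta ^+ 2 = 2).

(** The cap joins the shaded regions [k] and [k.+1] of [w] into one region of the capped word, so
    both carry the colour [c k]; its weight [a] is that of the corresponding cup. The relations hold
    because a loop gives [a ^+ 2 = delta] and a zigzag gives [a * a^-1 = 1]. *)
Lemma color_eval_cap_even k w c : valid_word w -> (k < size w)%N ->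
  delta ^+ (cap_word k.*2 w).1 * color_eval (cap_word k.*2 w).2 c =
  a * color_eval w (add_color k (c k) c).
Proof.
elim: w k c => [|i w IH] k c //; rewrite [valid_word _]/= [size _]/=.
move=> /andP[hi hw] hk; rewrite /= in hk.
case: cap_word_consP => [E|E|E| j' ej hlt | i' ei hlt]; rewrite [_.1]/= [_.2]/=.
- rewrite E /= odd_double doubleK.
  rewrite (@eq_color_eval w (del_color _ _) c); last by move=> x; color_lia.
  rewrite /add_color leqnn ltnn eqxx eqxx mulr1 expr1 -a2; ring.
- rewrite E /= odd_double /= uphalf_double.
  rewrite (@eq_color_eval w (del_color _ _) c); last by move=> x; color_lia.
  by rewrite mulVKf // mul1r.
- have [k' ek] : exists k', k = k'.+1 by exists k.-1; lia.
  have ei : i = k'.*2.+1 by lia.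
  rewrite ei /= odd_double /= uphalf_double.
  rewrite (@eq_color_eval w (del_color _ _) c); last by move=> x; color_lia.
  by rewrite mulVKf // mul1r.
- have [k' ek] : exists k', k = k'.+1 by exists k.-1; lia.
  have ej' : j' = k'.*2 by lia.
  have hk' : (k' < size w)%N by lia.
  rewrite ej' [color_eval _ c]/= mulrCA IH //.
  rewrite mulrCA; congr (_ * _).
  rewrite [RHS]/=; case: ifP => io.
    congr (_ * _); apply: eq_color_eval => x; color_lia.
  have -> : (add_color k (c k) c i./2 == add_color k (c k) c i./2.+1)
          = (c i./2 == c i./2.+1) by congr (_ == _); color_lia.
  case: eqP => ec; last by rewrite mulr0 !mul0r.
  congr (_ * _); apply: eq_color_eval => x.
  (* When the cup borders the cap, the doubled colour is that of region [k'] on one side of the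
     equation and that of region [k] on the other; [ec] makes them equal. *)
  have [em|em] := eqVneq i./2 k'; last by color_lia.
  rewrite em -ek in ec; rewrite em -?ec; color_lia.
have [m em] : exists m, m = i'./2 by exists i'./2.
have hk' : (k < size w)%N by lia.
rewrite [color_eval _ c]/= mulrCA IH //.
rewrite mulrCA; congr (_ * _).
rewrite [RHS]/= ei /= negbK -em; case: ifP => io.
  congr (_ * _); apply: eq_color_eval => x; color_lia.
have -> : (add_color k (c k) c m.+1 == add_color k (c k) c m.+2)
        = (c m == c m.+1) by congr (_ == _); color_lia.
congr (_ * _); apply: eq_color_eval => x; color_lia.
Qed.

(** Here the cap closes off the shaded region [k.+1], whose colour is invisible from outside and
    hence summed over, with weight [a^-1]. *)
Lemma color_eval_cap_odd k w c : valid_word w -> (k < size w)%N ->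
  delta ^+ (cap_word k.*2.+1 w).1 * color_eval (cap_word k.*2.+1 w).2 c =
  a^-1 * (color_eval w (add_color k true c) + color_eval w (add_color k false c)).
Proof.
elim: w k c => [|i w IH] k c //; rewrite [valid_word _]/= [size _]/=.
move=> /andP[hi hw] hk; rewrite /= in hk.
case: cap_word_consP => [E|E|E| j' ej hlt | i' ei hlt]; rewrite [_.1]/= [_.2]/=.
- rewrite E /= odd_double /= uphalf_double.
  rewrite !(@eq_color_eval w (del_color _ _) c); try by move=> x; color_lia.
  (* A loop around a shaded region: two colours of weight [a^-2] each give [2 / delta], which is
     [delta]. *)
  have : delta != 0 by rewrite -a2 expf_neq0.
  rewrite -mulrDr -mulr2n -mulr_natl -delta2 expr1 -a2 => d0.
  by field.
- rewrite E -doubleS /= odd_double /= doubleK expr0 mul1r.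
  have e1 b' : (add_color k b' c k.+1 == add_color k b' c k.+2) = (b' == c k.+1).
    by congr (_ == _); color_lia.
  rewrite !e1.
  have e2 b' : a * (b' == c k.+1)%:R *
      color_eval w (del_color k.+1 (add_color k b' c))
    = a * (b' == c k.+1)%:R * color_eval w c.
    case: eqP => eb; last by rewrite mulr0 !mul0r.
    by congr (_ * _); apply: eq_color_eval => x; rewrite eb; color_lia.
  rewrite !e2 -mulrDl -mulrDr -mulrA mulKf //.
  by case: (c k.+1); rewrite /= ?addr0 ?add0r mul1r.
- have ei : i = k.*2 by lia.
  rewrite ei /= odd_double doubleK expr0 mul1r.
  have e1 b' : (add_color k b' c k == add_color k b' c k.+1) = (b' == c k).
    by rewrite eq_sym; congr (_ == _); color_lia.
  rewrite !e1 !(@eq_color_eval w (del_color _ _) c); try by move=> x; color_lia.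
  rewrite -mulrDl -mulrDr -mulrA mulKf //.
  by case: (c k); rewrite /= ?addr0 ?add0r mul1r.
- have [k' ek] : exists k', k = k'.+1 by exists k.-1; lia.
  have ej' : j' = k'.*2.+1 by lia.
  have hk' : (k' < size w)%N by lia.
  rewrite ej' [color_eval _ c]/= mulrCA IH //.
  rewrite mulrCA; congr (_ * _).
  rewrite [color_eval (i :: _) _]/= [color_eval (i :: _) _]/= mulrDr.
  have e1 b' : (add_color k b' c i./2 == add_color k b' c i./2.+1)
          = (c i./2 == c i./2.+1) by congr (_ == _); color_lia.
  rewrite !e1.
  by congr (_ * _ + _ * _); apply: eq_color_eval => x; color_lia.
have [m em] : exists m, m = i'./2 by exists i'./2.
have hk' : (k < size w)%N by lia.
rewrite [color_eval _ c]/= mulrCA IH //.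
rewrite mulrCA; congr (_ * _).
rewrite [color_eval (i :: _) _]/= [color_eval (i :: _) _]/= ei /= negbK -em mulrDr.
case: ifP => io.
  by congr (_ * _ + _ * _); apply: eq_color_eval => x; color_lia.
have e1 b' : (add_color k b' c m.+1 == add_color k b' c m.+2)
        = (c m == c m.+1) by congr (_ == _); color_lia.
rewrite !e1.
by congr (_ * _ + _ * _); apply: eq_color_eval => x; color_lia.
Qed.
(** Up to the factor [delta], this pairs the expansion of a tree with a single diagram. By
    [loops_ins] the last cup of the tree becomes a cap on [v]. The odd position, with coefficient
    [a], sums over both colours of the new region; the even one, with coefficient [b], subtracts the
    colour of region [k] since [a * b = -1]. Only the opposite colour survives. *)
Lemma sum_caret_terms_loops ks v :
  valid_carets ks -> valid_word v -> size v = size ks ->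
  \sum_(t <- caret_terms ks) t.1 *
    delta ^+ loops (size ks).+1.*2 (word_matching t.2) (word_matching v) =
  color_eval v (caret_color ks).
Proof.
elim: ks v => [|k ks IH] v.
  by case: v => // *; rewrite big_seq1 /= loops_base mul1r.
rewrite [valid_carets _]/= [size _]/= => /andP[hk hks] hv sv; rewrite /= in sv.
rewrite [caret_terms _]/= big_cat !big_map /=.
have mv := matching_word hv; rewrite sv doubleS in mv.
have [F FE] : exists F : nat -> seq nat -> K, forall j w, F j w =
    delta ^+ loops (size ks).+2.*2 (ins_pair j (word_matching w)) (word_matching v).
  by eexists.
have step (j : nat) : (j < (size v).*2)%N ->
  \sum_(t <- caret_terms ks) t.1 * F j t.2 =
  delta ^+ (cap_word j v).1 * color_eval (cap_word j v).2 (caret_color ks).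
  move=> hj; have [hv' sv'] := cap_word_valid hv hj.
  rewrite -IH //; last by lia.
  rewrite mulr_sumr [LHS]big_seq [RHS]big_seq; apply: eq_bigr => t ht.
  have [vt st] := caret_terms_valid hks ht.
  have mt : matching (size ks).+1.*2 (word_matching t.2).
    by rewrite -st; apply: matching_word.
  have jks : (j <= (size ks).+1.*2)%N by lia.
  rewrite FE doubleS (loops_ins mt mv jks) exprD -(cap_word_fst hv hj) mulrCA.
  rewrite (@eq_loops _ _ _ (word_matching (cap_word j v).2)) // => i hi.
  by rewrite cap_word_matching //; lia.
have fold (x : K) j : \sum_(t <- caret_terms ks) x * t.1 *
    delta ^+ loops (size ks).+2.*2 
      (ins_pair j (word_matching t.2)) (word_matching v) =
    x * \sum_(t <- caret_terms ks) t.1 * F j t.2.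
  by rewrite mulr_sumr; apply: eq_bigr => t _; rewrite FE mulrA.
have h1 : (k.*2.+1 < (size v).*2)%N by lia.
have h0 : (k.*2 < (size v).*2)%N by lia.
transitivity (a * \sum_(t <- caret_terms ks) t.1 * F k.*2.+1 t.2 +
    b * \sum_(t <- caret_terms ks) t.1 * F k.*2 t.2).
  by apply: congr2; exact: fold.
rewrite (step _ h1) (step _ h0).
rewrite color_eval_cap_odd ?color_eval_cap_even //; try by lia.
rewrite !mulrA mulfV // mul1r (mulrC b) ab mulN1r.
by case: (caret_color ks k); rewrite /= ?addrK // addrAC subrr add0r.
Qed.

(** The odd cup of a caret contributes 1, and the even one contributes -1 if [c k = c k.+1] and 0
    otherwise. The two terms thus cancel unless [c] differs on the two branches. The condition at 0
    fixes the leftmost colour, which no caret changes. *)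
Lemma sum_caret_terms_eval ks (c : nat -> bool) :
  valid_carets ks -> c 0%N = false ->
  \sum_(t <- caret_terms ks) t.1 * color_eval t.2 c =
  [forall i : 'I_(size ks).+1, c i == caret_color ks i]%:R * delta.
Proof.
elim: ks c => [|k ks IH] c; first move=> _ c0.
  rewrite big_seq1 /= mul1r (_ : [forall i, _] = true) ?mul1r //.
  by apply/forallP => i; rewrite ord1 c0.
rewrite [valid_carets _]/= [size _]/= => /andP[hk hks] c0.
rewrite [caret_terms _]/= big_cat !big_map /=.
under eq_bigr do rewrite odd_double /= uphalf_double -mulrA (mulrCA _ a^-1)
  (mulrA a) mulfV // mul1r.
rewrite IH //.
under eq_bigr do rewrite odd_double /= doubleK -mulrA (mulrCA _ (a * _))
  (mulrA b) (mulrA b) (mulrC b) ab.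
rewrite -mulr_sumr IH //.
have -> : [forall i : 'I_(size ks).+2,
      c i == add_color k (~~ caret_color ks k) (caret_color ks) i] =
    (c k != c k.+1) && [forall i : 'I_(size ks).+1, del_color k c i == caret_color ks i].
  apply/forallP/andP => [h|[ck /forallP h] i].
    have hh i : (i <= (size ks).+1)%N ->
        c i = add_color k (~~ caret_color ks k) (caret_color ks) i.
      by move=> hi; have /eqP := h (Ordinal (hi : (i < (size ks).+2)%N)).
    split.
      rewrite !hh; try lia.
      by rewrite /add_color leqnn ltnn eqxx; case: (caret_color ks k).
    apply/forallP => -[i hi] /=; rewrite /del_color; case: ifP => ik.
      by rewrite hh /add_color ?ik //; lia.
    by rewrite hh // /add_color !ifF //; lia.
  have hh i' : (i' <= size ks)%N -> caret_color ks i' = del_color k c i'.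
    by move=> hi; have /eqP -> := h (Ordinal (hi : (i' < (size ks).+1)%N)).
  case: i => i hi /=; rewrite /add_color; case: ifP => ik.
    by rewrite hh ?/del_color ?ik //; lia.
  case: (eqVneq i k.+1) => [->|ik'].
    by rewrite hh // /del_color leqnn; case: (c k) ck; case: (c k.+1).
  rewrite hh; last by lia.
  by rewrite /del_color ifF; [apply/eqP; congr c; lia | lia].
case: eqP => _ /=; first by ring.
by rewrite /= mulr0 mul0r addr0.
Qed.
End Evaluation.

(** * Diagrams *)

Lemma diagramK m n (d : diagram m n) : involutive d.
Proof. by move=> p; case/andP: (valP d) => /forallP/(_ p)/andP[_ /eqP]. Qed.

Lemma diagram_neq m n (d : diagram m n) p : d p != p.
Proof. by case/andP: (valP d) => /forallP/(_ p)/andP[]. Qed.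

Lemma diagram_nc m n (d : diagram m n) p q :
  ~~ [&& boundary_pos p < boundary_pos q, boundary_pos q < boundary_pos (d p)
       & boundary_pos (d p) < boundary_pos (d q)].
Proof. by case/andP: (valP d) => _ /forallP/(_ p)/forallP/(_ q). Qed.

Lemma diagram_eq m n (c d : diagram m n) : c =1 d -> c = d.
Proof. by move=> h; apply: val_inj; apply/ffunP. Qed.

Lemma mk_diagram m n (g : 'I_m + 'I_n -> 'I_m + 'I_n) :
  (forall p, g p != p) -> involutive g ->
  (forall p q, ~~ [&& boundary_pos p < boundary_pos q,
    boundary_pos q < boundary_pos (g p) & boundary_pos (g p) < boundary_pos (g q)]) ->
  exists d : diagram m n, d =1 g.
Proof.
move=> h1 h2 h3; have h : noncrossing_pairing (finfun g).
  apply/andP; split; first by apply/forallP => p; rewrite !ffunE h1 h2 eqxx.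
  by apply/forallP => p; apply/forallP => q; rewrite !ffunE h3.
by exists (Diagram h) => p; rewrite ffunE.
Qed.

Lemma id_diagram n : exists d : diagram n n, forall i, d (inl i) = inr i.
Proof.
have [|||d dE] := @mk_diagram n n
  (fun p => match p with inl i => inr i | inr i => inl i end).
- by case.
- by case.
- by case=> i [] j /=; have := ltn_ord i; have := ltn_ord j; lia.
by exists d => i; rewrite dE.
Qed.

Lemma cup_diagram : exists d : diagram 0 2, d (inr ord0) = inr ord_max.
Proof.
have [|||d dE] := @mk_diagram 0 2 (fun p => match p with inl i => inl i
  | inr i => inr (rev_ord i) end).
- by case=> [[]//|[[|[|]]]].
- by case=> // i; rewrite rev_ordK.
- by case=> [[]//|i] [[]//|j] /=; have := ltn_ord i; have := ltn_ord j; lia.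
by exists d; rewrite dE; congr inr; apply: val_inj.
Qed.

Lemma left_pt_boundary m1 n1 m2 n2 (p : 'I_m1 + 'I_n1) :
  boundary_pos (left_pt m2 n2 p) =
  if boundary_pos p < m1 then boundary_pos p else boundary_pos p + m2 + n2.
Proof.
case: p => [i|j] /=; first by rewrite ltn_ord.
by have := ltn_ord j; rewrite ifF; lia.
Qed.

Lemma right_pt_boundary m1 n1 m2 n2 (p : 'I_m2 + 'I_n2) :
  boundary_pos (right_pt m1 n1 p) = m1 + boundary_pos p.
Proof. by case: p => [i|j] //=; have := ltn_ord j; lia. Qed.

Lemma boundary_pos_lt m n (p : 'I_m + 'I_n) : boundary_pos p < m + n.
Proof. by case: p => [i|j] /=; [have := ltn_ord i| have := ltn_ord j]; lia. Qed.

(** Valued in [Type], so that the juxtaposition of two diagrams can be defined by matching on it. *)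
Variant juxt_pt_spec m1 n1 m2 n2 : 'I_(m1 + m2) + 'I_(n1 + n2) -> Type :=
| JuxtLeft p : juxt_pt_spec (left_pt m2 n2 p)
| JuxtRight q : juxt_pt_spec (right_pt m1 n1 q).

Lemma juxt_ptP m1 n1 m2 n2 (r : 'I_(m1 + m2) + 'I_(n1 + n2)) : juxt_pt_spec r.
Proof.
case: r => i; rewrite -(fintype.splitK i); case: (fintype.split i) => j /=.
- exact: (@JuxtLeft m1 n1 m2 n2 (inl j)).
- exact: (@JuxtRight m1 n1 m2 n2 (inl j)).
- exact: (@JuxtLeft m1 n1 m2 n2 (inr j)).
exact: (@JuxtRight m1 n1 m2 n2 (inr j)).
Qed.

Lemma juxtaposes_eq m1 n1 m2 n2 (d : diagram m1 n1) (e : diagram m2 n2) c c' :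
  juxtaposes d e c -> juxtaposes d e c' -> c = c'.
Proof.
move=> /andP[/forallP h1 /forallP h2] /andP[/forallP k1 /forallP k2].
by apply: diagram_eq => r; case: (juxt_ptP r) => p;
  rewrite ?(eqP (h1 p)) ?(eqP (h2 p)) ?(eqP (k1 p)) ?(eqP (k2 p)).
Qed.

Lemma juxt_diagram m1 n1 m2 n2 (d : diagram m1 n1) (e : diagram m2 n2) :
  exists c, juxtaposes d e c.
Proof.
pose g (r : 'I_(m1 + m2) + 'I_(n1 + n2)) := match juxt_ptP r with
  | JuxtLeft p => left_pt m2 n2 (d p) | JuxtRight q => right_pt m1 n1 (e q) end.
have lR (p : 'I_m1 + 'I_n1) (q : 'I_m2 + 'I_n2) :
    left_pt m2 n2 p != right_pt m1 n1 q.
  by case: p q => i [] j //=; apply/eqP => -[E]; have := ltn_ord i; lia.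
have lI : injective (@left_pt m1 n1 m2 n2).
  by case=> i [] j //= [] /val_inj ->.
have rI : injective (@right_pt m1 n1 m2 n2).
  by case=> i [] j //= [] /addnI/val_inj ->.
(* [juxt_ptP] does not compute, so the values of [g] are recovered from the injectivity and
   disjointness of the two inclusions. *)
have gl p : g (left_pt m2 n2 p) = left_pt m2 n2 (d p).
  rewrite /g; move E : (left_pt _ _ p) => r; case: juxt_ptP E => q.
    by move/lI ->.
  by move/eqP; rewrite (negPf (lR _ _)).
have gr p : g (right_pt m1 n1 p) = right_pt m1 n1 (e p).
  rewrite /g; move E : (right_pt _ _ p) => r; case: juxt_ptP E => q.
    by move/eqP; rewrite eq_sym (negPf (lR _ _)).
  by move/rI ->.
have [r|r|r s|c cE] := @mk_diagram _ _ g.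
- case: (juxt_ptP r) => p; rewrite ?gl ?gr ?(inj_eq lI) ?(inj_eq rI);
  exact: diagram_neq.
- by case: (juxt_ptP r) => p; rewrite ?gl ?gr ?gl ?gr ?diagramK.
- case: (juxt_ptP r) => p; case: (juxt_ptP s) => q;
    rewrite ?gl ?gr ?left_pt_boundary ?right_pt_boundary.
  + by have := diagram_nc d p q; do 4?case: ifP; lia.
  + have := boundary_pos_lt q; have := boundary_pos_lt (e q).
    by do 2?case: ifP; lia.
  + have := boundary_pos_lt p; have := boundary_pos_lt (e p).
    by do 2?case: ifP; lia.
  by have := diagram_nc e p q; lia.
exists c; apply/andP; split; apply/forallP => p; rewrite cE ?gl ?gr //.
Qed.

(** * The image of a caret in the basis of diagrams *)

Section DiagramBasis.
Local Open Scope ring_scope.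
Variables (K : numClosedFieldType) (delta a b : K).

Definition diagram_vec m n (d : diagram m n) : TL K m n :=
  [ffun c => (c == d)%:R].

Lemma tl_id_vec n (d : diagram n n) :
  (forall i, d (inl i) = inr i) -> tl_id K n = diagram_vec d.
Proof.
move=> dE; apply/ffunP => c; rewrite !ffunE; congr (nat_of_bool _)%:R.
apply/forallP/eqP => [h|-> i]; last by rewrite dE.
have h1 i : c (inl i) = inr i by apply/eqP.
apply: diagram_eq => -[] i; first by rewrite h1 dE.
by rewrite -{1}h1 -dE !diagramK.
Qed.

Lemma tl_cup_vec (d : diagram 0 2) : tl_cup K = diagram_vec d.
Proof.
apply/ffunP => c; rewrite !ffunE (_ : c = d) ?eqxx //.
have h (e : diagram 0 2) : e (inr ord0) = inr ord_max.
  have := diagram_neq e (inr ord0); case: (e _) => [[]//|[[|[|i]]] hi] //=.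
  by move=> _; congr inr; apply: val_inj.
apply: diagram_eq => -[[]//|[[|[|i]]] hi] //.
  by rewrite (_ : Ordinal hi = ord0) ?h //; apply: val_inj.
rewrite (_ : Ordinal hi = ord_max); last exact: val_inj.
by rewrite -{1}(h c) -(h d) !diagramK.
Qed.

Lemma tl_juxt_vec m1 n1 m2 n2 (d : diagram m1 n1) (e : diagram m2 n2) c :
  juxtaposes d e c ->
  tl_juxt (diagram_vec d) (diagram_vec e) = diagram_vec c :> TL K _ _.
Proof.
move=> hc; apply/ffunP => c'; rewrite !ffunE (bigD1 d) //= addrC big1 => [|d' nd].
  rewrite add0r (_ : (c' == c) = juxtaposes d e c').
    rewrite big_mkcond (bigD1 e) //= addrC big1 => [|e' ne].
      by rewrite !ffunE !eqxx mulr1 add0r; case: ifP.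
    by rewrite !ffunE (negPf ne) mulr0; case: ifP.
  apply/eqP/idP => [->//|h]; exact: juxtaposes_eq h hc.
by apply: big1 => e' _; rewrite !ffunE (negPf nd) mul0r.
Qed.

Lemma tl_juxtDl m1 n1 m2 n2 (x x' : TL K m1 n1) (y : TL K m2 n2) u v :
  tl_juxt (u *: x + v *: x') y = u *: tl_juxt x y + v *: tl_juxt x' y.
Proof.
apply/ffunP => c; rewrite !ffunE !scaler_sumr -big_split.
apply: eq_bigr => d _; rewrite !scaler_sumr -big_split.
by apply: eq_bigr => e _; rewrite !ffunE mulrDl -!mulrA.
Qed.

Lemma tl_juxtDr m1 n1 m2 n2 (x : TL K m1 n1) (y y' : TL K m2 n2) u v :
  tl_juxt x (u *: y + v *: y') = u *: tl_juxt x y + v *: tl_juxt x y'.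
Proof.
apply/ffunP => c; rewrite !ffunE !scaler_sumr -big_split.
apply: eq_bigr => d _; rewrite !scaler_sumr -big_split.
by apply: eq_bigr => e _; rewrite !ffunE mulrDr !(mulrCA (x d)).
Qed.

Lemma tl_castD m m' n n' (em : m = m') (en : n = n') (x y : TL K m n) u v :
  tl_cast em en (u *: x + v *: y) = u *: tl_cast em en x + v *: tl_cast em en y.
Proof. by case: _ / en; case: _ / em. Qed.

(* [creates j e] : [e] consists of through strings and one cup joining the top
   points [j] and [j.+1]. *)
Definition creates j m n (e : diagram m n) :=
  (forall i, exists2 t : 'I_n, e (inl i) = inr t & t = skip2 j i :> nat) /\
  (forall t : 'I_n, t = j :> nat ->
    exists2 t' : 'I_n, e (inr t) = inr t' & t' = j.+1 :> nat).

Lemma creates_cup (d : diagram 0 2) : d (inr ord0) = inr ord_max -> creates 0 d.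
Proof.
move=> dE; split=> [[]//|[[|[|t]]] ht] //= _; exists ord_max => //.
by rewrite -dE; congr (d (inr _)); apply: val_inj.
Qed.

Lemma creates_juxt_id j k m n (d : diagram k k) (e : diagram m n) c :
  (forall i, d (inl i) = inr i) -> creates j e -> juxtaposes d e c ->
  creates (k + j) c.
Proof.
move=> dE [e1 e2] /andP[/forallP h1 /forallP h2]; split.
  move=> i; rewrite -(fintype.splitK i); case: (fintype.split i) => i' /=.
    exists (lshift n i'); first by have /eqP := h1 (inl i'); rewrite /= dE.
    by rewrite /= /skip2 ifT //; have := ltn_ord i'; lia.
  have [t et ht] := e1 i'; exists (rshift k t).
    by have /eqP := h2 (inl i'); rewrite /= et.
  by rewrite /= ht /skip2; do 2?case: ifP; lia.
move=> t ht; have tk : (k <= t)%N by lia.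
have tn : (t - k < n)%N by have := ltn_ord t; lia.
have htk : Ordinal tn = j :> nat by rewrite /=; lia.
have [t' et' ht'] := e2 _ htk; exists (rshift k t'); last by rewrite /= ht'; lia.
have /eqP := h2 (inr (Ordinal tn)); rewrite /= et' /= => <-.
by congr (c (inr _)); apply: val_inj; rewrite /=; lia.
Qed.

Lemma creates_juxtr_id j k m n (d : diagram k k) (e : diagram m n) c :
  (j <= m)%N -> n = m.+2 ->
  (forall i, d (inl i) = inr i) -> creates j e -> juxtaposes e d c ->
  creates j c.
Proof.
move=> jm nm dE [e1 e2] /andP[/forallP h1 /forallP h2]; split.
  move=> i; rewrite -(fintype.splitK i); case: (fintype.split i) => i' /=.
    have [t et ht] := e1 i'; exists (lshift k t) => //.
    by have /eqP := h1 (inl i'); rewrite /= et.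
  exists (rshift n i'); first by have /eqP := h2 (inl i'); rewrite /= dE.
  by rewrite /= /skip2; case: ifP; lia.
move=> t ht; have tn : (t < n)%N by lia.
have [t' et' ht'] := e2 (Ordinal tn) ht; exists (lshift k t') => //.
have /eqP := h1 (inr (Ordinal tn)); rewrite /= et' /= => <-.
by congr (c (inr _)); apply: val_inj.
Qed.

Lemma tl_cast_vec j m m' n n' (em : m = m') (en : n = n') (e : diagram m n) :
  creates j e -> exists2 e' : diagram m' n',
    tl_cast em en (diagram_vec e) = diagram_vec e' & creates j e'.
Proof. by case: _ / em; case: _ / en => h; exists e. Qed.

(** The two terms of [rho] put the cup to the right or to the left of the through string, at
    position 1 or 0, and the [k.*2] strings on the left shift this position. *)
Lemma Phi_caret_vec n (k : 'I_n) : exists e1 e0 : diagram n.*2.-1 n.+1.*2.-1,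
  [/\ Phi_caret a b k = a *: diagram_vec e1 + b *: diagram_vec e0,
      creates k.*2.+1 e1 & creates k.*2 e0].
Proof.
have [i1 i1E] := id_diagram 1; have [il ilE] := id_diagram k.*2.
have [ir irE] := id_diagram (n - k.+1).*2; have [u uE] := cup_diagram.
have cu := creates_cup uE.
have [c1 h1] := juxt_diagram i1 u; have [c0 h0] := juxt_diagram u i1.
have cr1 := creates_juxt_id i1E cu h1.
have cr0 := creates_juxtr_id (leqnn 0) erefl i1E cu h0.
have [d1 k1] := juxt_diagram il c1; have [d0 k0] := juxt_diagram il c0.
have dr1 := creates_juxt_id ilE cr1 k1; have dr0 := creates_juxt_id ilE cr0 k0.
have [f1 l1] := juxt_diagram d1 ir; have [f0 l0] := juxt_diagram d0 ir.
have fr1 : creates (k.*2 + (1 + 0)) f1.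
  by apply: creates_juxtr_id irE dr1 l1; lia.
have fr0 : creates (k.*2 + 0) f0.
  by apply: creates_juxtr_id irE dr0 l0; lia.
have [g1 G1 gr1] := tl_cast_vec (Phi_caret_dom k) (Phi_caret_cod k) fr1.
have [g0 G0 gr0] := tl_cast_vec (Phi_caret_dom k) (Phi_caret_cod k) fr0.
exists g1, g0; split; last 2 first.
- by rewrite addn1 in gr1.
- by rewrite addn0 in gr0.
rewrite /Phi_caret /rho (tl_id_vec i1E) (tl_cup_vec u) (tl_id_vec ilE).
rewrite (tl_id_vec irE) (tl_juxt_vec h1) (tl_juxt_vec h0) tl_juxtDr.
rewrite (tl_juxt_vec k1) (tl_juxt_vec k0) tl_juxtDl (tl_juxt_vec l1).
by rewrite (tl_juxt_vec l0) tl_castD G1 G0.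
Qed.
End DiagramBasis.

(** * Composition of diagrams by gluing *)

Section Gluing.
Variables (m n k : nat) (e : diagram n k) (d : diagram m n).
Let R := glue_rel e d.

Lemma glue_lower p : R (lower_pt k p) (lower_pt k (d p)).
Proof. by apply/orP; left; apply/existsP; exists p; rewrite !eqxx. Qed.

Lemma glue_upper q : R (upper_pt m q) (upper_pt m (e q)).
Proof. by apply/orP; right; apply/existsP; exists q; rewrite !eqxx. Qed.

Lemma glueP x y : R x y ->
  (exists2 p, x = lower_pt k p & y = lower_pt k (d p)) \/
  (exists2 q, x = upper_pt m q & y = upper_pt m (e q)).
Proof.
by case/orP=> /existsP[p /andP[/eqP-> /eqP->]]; [left | right]; exists p.
Qed.

Lemma glue_sym : connect_sym R.
Proof.
apply/sym_connect_sym => x y; apply/idP/idP => /glueP[] [p -> ->].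
- by rewrite -{2}(diagramK d p) glue_lower.
- by rewrite -{2}(diagramK e p) glue_upper.
- by rewrite -{2}(diagramK d p) glue_lower.
by rewrite -{2}(diagramK e p) glue_upper.
Qed.

(* [f] labels the vertices so that gluing edges join equal or matched labels:
   it sends each component to one arc of [c]. *)
Lemma concatenates_unique (c c' : diagram m k)
    (f : 'I_m + 'I_n + 'I_k -> 'I_m + 'I_k) :
  (forall r, f (outer_pt n r) = r) ->
  (forall p, f (lower_pt k (d p)) \in [:: f (lower_pt k p); c (f (lower_pt k p))]) ->
  (forall q, f (upper_pt m (e q)) \in [:: f (upper_pt m q); c (f (upper_pt m q))]) ->
  concatenates e d c' -> c' = c.
Proof.
move=> fo fl fu /forallP hc; apply: diagram_eq => r.
have inv x y : connect R x y -> f y \in [:: f x; c (f x)].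
  case/connectP => s; elim: s x => [|z s IH] x /=; first by move=> _ ->; rewrite inE eqxx.
  case/andP => /glueP xz /IH h /h {h}.
  have : f z \in [:: f x; c (f x)] by case: xz => -[p -> ->].
  rewrite !inE => /orP[] /eqP -> //; by rewrite diagramK orbC.
have := inv _ _ (hc r); rewrite !fo !inE => /orP[] /eqP // h.
by have := diagram_neq c' r; rewrite h eqxx.
Qed.

Lemma closed_loops_eq0 :
  (forall x, exists r, connect R (outer_pt n r) x) -> closed_loops e d = 0.
Proof.
move=> h; apply: eq_card0 => x; rewrite !inE; apply/negbTE/nandP; right.
by have [r hr] := h x; apply/forallPn; exists r; rewrite negbK.
Qed.

End Gluing.

Section CompositionBasis.
Local Open Scope ring_scope.
Variables (K : numClosedFieldType) (delta : K).

Lemma tl_comp_vecr m n k (y : TL K n k) (d : diagram m n) c :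
  tl_comp delta y (diagram_vec K d) c =
  \sum_(e | concatenates e d c) y e * delta ^+ closed_loops e d.
Proof.
rewrite ffunE (bigD1 d) //= addrC big1 => [|d' nd].
  by rewrite add0r; apply: eq_bigr => e _; rewrite ffunE eqxx mulr1.
by apply: big1 => e _; rewrite ffunE (negPf nd) mulr0 mul0r.
Qed.

Lemma tl_comp_vec m n k (e : diagram n k) (d : diagram m n) c :
  tl_comp delta (diagram_vec K e) (diagram_vec K d) c =
  (concatenates e d c)%:R * delta ^+ closed_loops e d.
Proof.
rewrite tl_comp_vecr big_mkcond (bigD1 e) //= addrC big1 => [|e' ne].
  by rewrite add0r ffunE eqxx; case: ifP; rewrite ?mul0r.
by rewrite ffunE (negPf ne) mul0r; case: ifP.
Qed.

Lemma tl_comp_id m (X : TL K 1 m) : tl_comp delta X (tl_id K 1) = X.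
Proof.
have [d dE] := id_diagram 1; have dE0 : d (inl ord0) = inr ord0 := dE ord0.
have dE1 : d (inr ord0) = inl ord0 by rewrite -dE0 diagramK.
rewrite (tl_id_vec _ dE); apply/ffunP => c; rewrite tl_comp_vecr.
pose f (x : 'I_1 + 'I_1 + 'I_m) : 'I_1 + 'I_m :=
  match x with inl _ => inl ord0 | inr t => inr t end.
have fo r : f (outer_pt 1 r) = r by case: r => // i; rewrite /= (ord1 i).
have fu q : f (upper_pt 1 q) = q by case: q => // i; rewrite /= (ord1 i).
have mid (e : diagram 1 m) : connect (glue_rel e d) (inl (inl ord0)) (inl (inr ord0)).
  by apply: connect1; have := glue_lower e d (inl ord0); rewrite dE0.
have up (e : diagram 1 m) q :
    connect (glue_rel e d) (outer_pt 1 q) (upper_pt 1 q).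
  by case: q => i; rewrite /= ?(ord1 i) ?connect0.
have cE (e c' : diagram 1 m) : concatenates e d c' = (c' == e).
  apply/idP/eqP => [|->].
    apply: (concatenates_unique fo) => [[] p|q].
    - by rewrite (ord1 p) dE0 inE.
    - by rewrite (ord1 p) dE1 inE.
    by rewrite !fu !inE eqxx orbT.
  apply/forallP => r; apply: connect_trans (up e r) _.
  by apply: connect_trans (connect1 (glue_upper e d r)) _; rewrite glue_sym up.
rewrite (bigD1 c) ?cE //= big1 => [|e /andP[]]; last first.
  by rewrite cE => /eqP ->; rewrite eqxx.
rewrite closed_loops_eq0 ?mulr1 ?addr0 // => -[[i|i]|i].
- by exists (inl ord0); rewrite (ord1 i) connect0.
- by exists (inl ord0); rewrite (ord1 i) mid.
by exists (inr i); rewrite connect0.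
Qed.

Definition top_pos m (p : 'I_1 + 'I_m) : nat :=
  match p with inl _ => m | inr j => j end.

(* The top points come first and the bottom point last, which is the reverse
   of the order of [boundary_pos]. *)
Definition represents m (d : diagram 1 m) (f : nat -> nat) :=
  forall p, top_pos (d p) = f (top_pos p).

Lemma top_pos_inj m : injective (@top_pos m).
Proof.
case=> i [] j /=; rewrite ?(ord1 i) ?(ord1 j) //.
- by have := ltn_ord j; lia.
- by have := ltn_ord i; lia.
by move/val_inj->.
Qed.

Lemma top_pos_lt m (p : 'I_1 + 'I_m) : (top_pos p < m.+1)%N.
Proof. by case: p => i //=; have := ltn_ord i; lia. Qed.

Lemma top_pos_surj m u : (u < m.+1)%N -> exists p : 'I_1 + 'I_m, top_pos p == u.
Proof.
move=> um; case: (ltnP u m) => h; first by exists (inr (Ordinal h)).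
by exists (inl ord0); rewrite /= eqn_leq h -ltnS um.
Qed.

Lemma boundary_top_pos m (p : 'I_1 + 'I_m) : boundary_pos p = (m - top_pos p)%N.
Proof. by case: p => i /=; have := ltn_ord i; lia. Qed.

Lemma matching_diagram m f : matching m.+1 f ->
  exists d : diagram 1 m, represents d f.
Proof.
move=> [flt fK fneq fnc].
have hg (p : 'I_1 + 'I_m) : exists q : 'I_1 + 'I_m, top_pos q == f (top_pos p).
  exact: top_pos_surj (flt _ (top_pos_lt p)).
pose g p := xchoose (hg p); have gE p : top_pos (g p) = f (top_pos p).
  exact/eqP/(xchooseP (hg p)).
have [|||d dE] := @mk_diagram 1 m g.
- move=> p; apply/eqP => E; have := gE p; rewrite E => /eqP.
  by rewrite eq_sym (negPf (fneq _ (top_pos_lt _))).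
- by move=> p; apply: top_pos_inj; rewrite !gE fK // top_pos_lt.
- move=> p q; rewrite !boundary_top_pos !gE.
  (* Since [boundary_pos] reverses the order of [top_pos], a crossing of [p] and [q] becomes one of
     their partners, in the opposite order. *)
  have := fnc _ _ (flt _ (top_pos_lt q)) (flt _ (top_pos_lt p)).
  rewrite !fK ?top_pos_lt //; have := top_pos_lt p; have := top_pos_lt q.
  by have := flt _ (top_pos_lt p); have := flt _ (top_pos_lt q); lia.
by exists d => p; rewrite dE gE.
Qed.

(** Every orbit has two points, and [B] selects the one of smaller rank. *)
Lemma even_card_involution (T : finType) (g : T -> T) (A : {set T}) :
  involutive g -> (forall x, g x != x) -> (forall x, x \in A -> g x \in A) ->
  ~~ odd #|A|.
Proof.
move=> gK gneq gA; pose B := [set x in A | (enum_rank x < enum_rank (g x))%N].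
have -> : #|A| = (#|B| + #|B|)%N; last by rewrite addnn odd_double.
rewrite -[LHS](cardsID [set x | (enum_rank x < enum_rank (g x))%N]).
congr (_ + _)%N; first by apply: eq_card => x; rewrite !inE.
rewrite -[RHS](card_imset _ (can_inj gK)); apply: eq_card => x; rewrite !inE.
apply/andP/imsetP => [[nlt xA]|[y]].
  exists (g x); rewrite ?gK // !inE gK gA //=.
  have : enum_rank (g x) != enum_rank x by rewrite (inj_eq enum_rank_inj).
  by rewrite -(inj_eq val_inj) neq_ltn => /orP[//|h]; rewrite h in nlt.
by rewrite !inE => /andP[yA ylt] ->; rewrite gK gA // -leqNgt ltnW.
Qed.

(** The through strings of [e] carry each strand of [d] up to the top, and the cup of [e] has both
    ends there. Hence no loop arises. The labelling [F] moves the points of [d] up along the through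
    strings. *)
Lemma tl_comp_creates j m n (e : diagram m n) (d : diagram 1 m) f
    (d' : diagram 1 n) :
  n = m.+2 -> (j <= m)%N -> creates j e -> represents d f ->
  represents d' (ins_pair j f) ->
  tl_comp delta (diagram_vec K e) (diagram_vec K d) = diagram_vec K d'.
Proof.
move=> nm jm [e1 e2] df d'f; apply/ffunP => c; rewrite tl_comp_vec ffunE.
have skn (i : 'I_m) : (skip2 j i < n)%N.
  by rewrite nm /skip2; have := ltn_ord i; case: ifP; lia.
pose s i : 'I_n := Ordinal (skn i).
have eE i : e (inl i) = inr (s i).
  by have [t -> ht] := e1 i; congr inr; apply: val_inj.
have eE' i : e (inr (s i)) = inl i by rewrite -eE diagramK.
pose up (p : 'I_1 + 'I_m) : 'I_1 + 'I_n :=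
  match p with inl i => inl i | inr i => inr (s i) end.
have d'E p : d' (up p) = up (d p).
  apply: top_pos_inj; rewrite d'f.
  have upE q : top_pos (up q) = skip2 j (top_pos q).
    by case: q => //= i; rewrite nm /skip2 ifF //; lia.
  by rewrite !upE ins_pair_skip2 df.
have pair (t : 'I_n) : ~~ [exists i, t == s i] ->
    exists2 t', e (inr t) = inr t' & d' (inr t) = inr t'.
  move=> /existsPn nts.
  have tj : (t == j :> nat) || (t == j.+1 :> nat).
    apply/norP => -[tj tj']; have := skip2P (N := m) jm.
    have tn : (t < m.+2)%N by rewrite -nm.
    have := ltn_unskip2 jm tn tj tj' => ht.
    by have := nts (Ordinal ht); rewrite -(inj_eq val_inj) /= unskip2K ?eqxx.
  have jn : (j.+1 < n)%N by rewrite nm !ltnS.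
  pose J := Ordinal (ltnW jn); pose J' := Ordinal jn.
  have eJ : e (inr J) = inr J'.
    by have [t' -> ht'] := e2 J erefl; congr inr; apply: val_inj.
  have d'J : d' (inr J) = inr J'.
    by apply: top_pos_inj; rewrite d'f /= ins_pair_l.
  case/orP: tj => /eqP tj.
    by have -> : t = J by [apply: val_inj]; exists J'.
  have -> : t = J' by [apply: val_inj].
  by exists J; [rewrite -eJ diagramK | rewrite -d'J diagramK].
pose F (x : 'I_1 + 'I_m + 'I_n) : 'I_1 + 'I_n :=
  match x with inl p => up p | inr t => inr t end.
have Fo r : F (outer_pt m r) = r by case: r.
have Fl p : F (lower_pt n p) = up p by [].
have cn p : connect (glue_rel e d) (lower_pt n p) (outer_pt m (up p)).
  case: p => i; first exact: connect0.
  by apply: connect1; have := glue_upper e d (inl i); rewrite eE.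
rewrite (_ : concatenates e d c = (c == d')).
  rewrite closed_loops_eq0 ?mulr1 // => -[p|t]; last by exists (inr t); apply: connect0.
  by exists (up p); rewrite glue_sym; apply: cn.
apply/idP/eqP => [|->].
  apply: (concatenates_unique Fo) => [p|[i|t]].
  - by rewrite !Fl d'E !inE eqxx orbT.
  - by rewrite eE /= inE eqxx.
  have [/existsP[i /eqP ->]|/pair[t' -> E]] := boolP [exists i, t == s i].
    by rewrite eE' /= inE eqxx.
  by rewrite /= E !inE eqxx orbT.
apply/forallP => r.
have [/existsP[p /eqP ->]|nr] := boolP [exists p, r == up p].
  rewrite d'E glue_sym; apply: connect_trans (cn _).
  rewrite glue_sym; apply: connect_trans (cn _).
  exact: connect1 (glue_lower e d p).
case: r nr => [i|t] nr.
  by move/existsPn: nr => /(_ (inl i)); rewrite eqxx.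
have [|t' E1 E2] := pair t.
  apply: contra nr => /existsP[i /eqP ->].
  by apply/existsP; exists (inr i).
by apply: connect1; have := glue_upper e d (inr t); rewrite E1 E2.
Qed.
End CompositionBasis.

Lemma flip_ptK m n : cancel (@flip_pt m n) (@flip_pt n m).
Proof. by case. Qed.

Lemma flip_diagram m n (d : diagram m n) :
  exists e : diagram n m, forall p, e (flip_pt p) = flip_pt (d p).
Proof.
have fb (p : 'I_n + 'I_m) : boundary_pos p = m + n - (boundary_pos (flip_pt p)).+1.
  by case: p => i /=; have := ltn_ord i; lia.
have [p|p|p q|e eE] := @mk_diagram n m (fun p => flip_pt (d (flip_pt p))).
- by rewrite (can2_eq (@flip_ptK _ _) (@flip_ptK _ _)) diagram_neq.
- by rewrite flip_ptK diagramK flip_ptK.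
- rewrite !fb !flip_ptK; set p' := flip_pt p; set q' := flip_pt q.
  have := diagram_nc d (d q') (d p'); rewrite !diagramK.
  have := boundary_pos_lt p'; have := boundary_pos_lt q'.
  have := boundary_pos_lt (d p'); have := boundary_pos_lt (d q'); lia.
by exists e => p; rewrite eE flip_ptK.
Qed.

Section FlipGluing.
Variables (m : nat) (d : diagram 1 m) (e : diagram m 1).
Let R := glue_rel e d.
Let bot : 'I_1 + 'I_m + 'I_1 := inl (inl ord0).
Let top : 'I_1 + 'I_m + 'I_1 := inr ord0.

(** A parity argument. If the component of the bottom point missed the top point, its other points
    would form a set [M] of middle points. Pairing by [d] makes the size of [M] plus 1 even, and
    pairing by [e] makes the size of [M] even. *)
Lemma glue_bottom_top : connect R bot top.
Proof.
apply: contraT => nbt; pose L := [set p | connect R bot (lower_pt 1 p)].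
pose U := [set q | connect R bot (upper_pt 1 q)].
pose M := [set i : 'I_m | connect R bot (inl (inr i))].
have hL : ~~ odd #|L|.
  apply: even_card_involution (diagramK d) (diagram_neq d) _ => p; rewrite !inE.
  by move/connect_trans; apply; apply: connect1; apply: glue_lower.
have hU : ~~ odd #|U|.
  apply: even_card_involution (diagramK e) (diagram_neq e) _ => p; rewrite !inE.
  by move/connect_trans; apply; apply: connect1; apply: glue_upper.
have EL : L = inl ord0 |: [set inr i | i in M].
  apply/setP => -[i|i]; rewrite !inE /=.
    by rewrite (ord1 i) eqxx connect0.
  by rewrite (mem_imset _ _ inr_inj) inE.
have EU : U = [set inl i | i in M].
  apply/setP => -[i|i]; rewrite !inE /=.
    by rewrite (mem_imset _ _ inl_inj) inE.
  rewrite (ord1 i) (negPf nbt); apply/esym/negbTE/imsetP; by case.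
move: hL hU; rewrite EL EU cardsU1 !card_imset; try by move=> ? ? [].
have -> : (inl ord0 : 'I_1 + 'I_m) \notin [set inr i | i in M].
  by apply/imsetP; case.
by rewrite /= => /negbNE ->.
Qed.

Lemma concatenates_11 (c : diagram 1 1) : concatenates e d c.
Proof.
have c0 : c (inl ord0) = inr ord0.
  have := diagram_neq c (inl ord0); case: (c _) => i; rewrite (ord1 i) ?eqxx //.
apply/forallP => -[i|i]; rewrite (ord1 i).
  by rewrite c0 glue_bottom_top.
by rewrite -{2}c0 diagramK glue_sym glue_bottom_top.
Qed.

(** Identifying the bottom with the top point closes the only open strand, which gives one loop
    more. The result is the union of the two matchings, with the closing point as last point. *)
Lemma flip_closed_loops (d' : diagram 1 m) f f' :
  (forall p, e (flip_pt p) = flip_pt (d' p)) ->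
  matching m.+1 f -> matching m.+1 f' ->
  represents d f -> represents d' f' ->
  loops m.+1 f f' = (closed_loops e d).+1.
Proof.
move=> eE mf mf' df df'; pose R' := @loop_rel m.+1 f f'.
have symR : connect_sym R by apply: glue_sym.
have symR' : connect_sym R' by apply/sym_connect_sym/loop_rel_sym.
transitivity (n_comp R predT); last first.
  rewrite (n_compC (connect R bot)) n_comp_connect // add1n; congr _.+1.
  apply: eq_n_comp_r => x; rewrite !inE; apply/idP/forallP => [h r|h].
    case: r => i; rewrite /= (ord1 i) //.
    by apply: contra h => /(connect_trans glue_bottom_top).
  exact: (h (inl ord0)).
pose phi (x : 'I_1 + 'I_m + 'I_1) : 'I_m.+1 :=
  match x with inl p => Ordinal (top_pos_lt p) | inr _ => ord_max end.
have pos_ex (u : 'I_m.+1) : exists p : 'I_1 + 'I_m, top_pos p == u.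
  exact: top_pos_surj (ltn_ord u).
pose psi u := lower_pt 1 (xchoose (pos_ex u)).
have psiE p : psi (Ordinal (top_pos_lt p)) = lower_pt 1 p.
  by congr inl; apply: top_pos_inj; apply/eqP/(xchooseP (pos_ex _)).
have phiu (p : 'I_1 + 'I_m) : phi (upper_pt 1 (flip_pt p)) = top_pos p :> nat by case: p.
rewrite /loops -/R'; apply/esym.
have cu (p : 'I_1 + 'I_m) : connect R (lower_pt 1 p) (upper_pt 1 (flip_pt p)).
  by case: p => i /=; rewrite ?(ord1 i) ?connect0 // glue_bottom_top.
rewrite (@adjunction_n_comp _ _ psi R R' symR symR' predT) //.
refine (@intro_adjunction _ _ psi R R' symR' predT _ (fun x _ => phi x) _ _) => //.
  move=> x _; split.
    case: x => [p|i] /=; first by rewrite psiE connect0.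
    have -> : psi ord_max = bot.
      by rewrite -[RHS](psiE (inl ord0)); congr psi; apply: val_inj.
    by rewrite (ord1 i) symR; apply: glue_bottom_top.
  move=> y _ /glueP[] [p -> ->]; apply: connect1; apply/orP; [left|right].
    by apply/eqP; rewrite /= df.
  by apply/eqP; rewrite -(flip_ptK p) eE !phiu df'.
move=> u _; split.
  rewrite (_ : phi _ = u) ?connect0 //; apply: val_inj => /=.
  exact/eqP/(xchooseP (pos_ex u)).
move=> v; have [p up] := pos_ex u; have [q vq] := pos_ex v.
have -> : u = Ordinal (top_pos_lt p) by apply: val_inj; rewrite /= (eqP up).
have -> : v = Ordinal (top_pos_lt q) by apply: val_inj; rewrite /= (eqP vq).
rewrite !psiE => /orP[] /eqP /=.
  by rewrite -df => /top_pos_inj ->; apply: connect1; apply: glue_lower.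
rewrite -df' => /top_pos_inj ->; apply: connect_trans (cu p) _.
rewrite symR; apply: connect_trans (cu _) _.
by rewrite symR -eE; apply: connect1; apply: glue_upper.
Qed.

End FlipGluing.

Section Form.
Local Open Scope ring_scope.
Variables (K : numClosedFieldType) (delta : K).

Lemma tl_form_vec m (d d' : diagram 1 m) f f' :
  matching m.+1 f -> matching m.+1 f' -> represents d f -> represents d' f' ->
  delta * tl_form delta (diagram_vec K d) (diagram_vec K d') =
  delta ^+ loops m.+1 f f'.
Proof.
move=> mf mf' df df'; have [e eE] := flip_diagram d'.
rewrite (flip_closed_loops eE mf mf' df df') exprS; congr (_ * _).
rewrite /tl_form.
have -> : tl_dagger (diagram_vec K d') = diagram_vec K e.
  apply/ffunP => e'; rewrite !ffunE.
  rewrite (_ : (e' == e) = [forall p, e' (flip_pt p) == flip_pt (d' p)]).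
    rewrite big_mkcond (bigD1 d') //= addrC big1 => [|d2 nd].
      by rewrite add0r ffunE eqxx conjC1; case: ifP.
    by rewrite ffunE (negPf nd) conjC0; case: ifP.
  apply/eqP/forallP => [-> p|h]; first by rewrite eE.
  by apply: diagram_eq => p; rewrite -(flip_ptK p) eE; apply/eqP/h.
have [c0 _] := id_diagram 1.
under eq_bigr do rewrite tl_comp_vec concatenates_11 mul1r.
have all1 (c : diagram 1 1) : c = c0.
  have h (c' : diagram 1 1) : c' (inl ord0) = inr ord0.
    have := diagram_neq c' (inl ord0); case: (c' _) => i; rewrite (ord1 i) ?eqxx //.
  apply: diagram_eq => -[i|i]; rewrite (ord1 i) ?h //.
  by rewrite -{1}(h c) -(h c0) !diagramK.
by rewrite (bigD1 c0) //= big1 ?addr0 // => c; rewrite (all1 c) eqxx.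
Qed.

Lemma tl_compDr m n k (y : TL K n k) (x x' : TL K m n) u v :
  tl_comp delta y (u *: x + v *: x') =
  u *: tl_comp delta y x + v *: tl_comp delta y x'.
Proof.
apply/ffunP => c; rewrite !ffunE !scaler_sumr -big_split.
apply: eq_bigr => d _; rewrite !scaler_sumr -big_split.
by apply: eq_bigr => e _; rewrite !ffunE mulrDr mulrDl !(mulrCA (y e)) -!mulrA.
Qed.

Lemma tl_compDl m n k (y y' : TL K n k) (x : TL K m n) u v :
  tl_comp delta (u *: y + v *: y') x =
  u *: tl_comp delta y x + v *: tl_comp delta y' x.
Proof.
apply/ffunP => c; rewrite !ffunE !scaler_sumr -big_split.
apply: eq_bigr => d _; rewrite !scaler_sumr -big_split.
by apply: eq_bigr => e _; rewrite !ffunE !mulrDl -!mulrA.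
Qed.

Lemma tl_formDl m (x x' y : TL K 1 m) u v :
  tl_form delta (u *: x + v *: x') y =
  u * tl_form delta x y + v * tl_form delta x' y.
Proof.
rewrite /tl_form tl_compDr !mulr_sumr -big_split.
by apply: eq_bigr => c _; rewrite !ffunE.
Qed.

Lemma tl_formDr m (x y y' : TL K 1 m) u v :
  tl_form delta x (u *: y + v *: y') =
  u^* * tl_form delta x y + v^* * tl_form delta x y'.
Proof.
rewrite /tl_form (_ : tl_dagger _ = u^* *: tl_dagger y + v^* *: tl_dagger y').
  rewrite tl_compDl !mulr_sumr -big_split.
  by apply: eq_bigr => c _; rewrite !ffunE.
apply/ffunP => c; rewrite !ffunE !scaler_sumr -big_split.
by apply: eq_bigr => d _; rewrite !ffunE rmorphD !rmorphM.
Qed.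

End Form.

(** * Parities of right turns *)

Fixpoint right_parity (t : tree) : seq bool :=
  if t is Node l r then right_parity l ++ map negb (right_parity r)
  else [:: false].

Definition graft_parity (cs : seq bool) (f : seq tree) :=
  flatten [seq [seq p.1 (+) x | x <- right_parity p.2] | p <- zip cs f].

Lemma size_right_parity t : size (right_parity t) = leaves t.
Proof. by elim: t => //= l IHl r IHr; rewrite size_cat size_map IHl IHr. Qed.

Lemma graft_parity_cat cs cs' f f' : size cs = size f ->
  graft_parity (cs ++ cs') (f ++ f') = graft_parity cs f ++ graft_parity cs' f'.
Proof. by move=> h; rewrite /graft_parity zip_cat // map_cat flatten_cat. Qed.

Lemma graft_parity_cons c cs u f :
  graft_parity (c :: cs) (u :: f) =
  [seq c (+) x | x <- right_parity u] ++ graft_parity cs f.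
Proof. by []. Qed.

Lemma graft_parity_negb cs f :
  graft_parity (map negb cs) f = map negb (graft_parity cs f).
Proof.
elim: cs f => [|c cs IH] [|u f] //=; rewrite !graft_parity_cons IH map_cat.
by congr (_ ++ _); rewrite -map_comp; apply: eq_map => x /=; rewrite addNb.
Qed.

Lemma graft_parity_leaf cs n : size cs = n -> graft_parity cs (nseq n Leaf) = cs.
Proof.
by move=> <- {n}; elim: cs => //= c cs IH; rewrite graft_parity_cons IH /= addbF.
Qed.

Lemma right_parity_graft t f : size f = leaves t ->
  right_parity (graft t f) = graft_parity (right_parity t) f.
Proof.
elim: t f => [|l IHl r IHr] f.
  case: f => [|u [|]] //= _; rewrite graft_parity_cons cats0.
  by rewrite -[LHS]map_id; apply: eq_map.
case/seq_split => f1 [f2 [-> h1 h2]].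
rewrite graft_node //= IHl // IHr // graft_parity_cat ?graft_parity_negb //.
by rewrite size_right_parity.
Qed.

Definition caret_seq n k := nseq k Leaf ++ Node Leaf Leaf :: nseq (n - k.+1) Leaf.

Lemma size_caret_seq n k : k < n -> size (caret_seq n k) = n.
Proof. by move=> h; rewrite size_cat /= !size_nseq; lia. Qed.

(** [Phi] is built by stacking carets, so the induction on trees must remove a caret at the top. It
    is sought in the left subtree first. *)
Lemma tree_caret t : 1 < leaves t -> exists k t',
  [/\ k < leaves t', leaves t = (leaves t').+1 & t = graft t' (caret_seq (leaves t') k)].
Proof.
have lp u : 0 < leaves u by elim: u => //= l hl r hr; lia.
elim: t => //= l IHl r IHr _.
have [/IHl[k [l' [hk hl el]]]|hl] := ltnP 1 (leaves l).
  exists k, (Node l' r); split; [rewrite /=; lia|rewrite /=; lia|].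
  rewrite [l]el [leaves (Node _ _)]/= (_ : caret_seq (leaves l' + leaves r) k =
    caret_seq (leaves l') k ++ nseq (leaves r) Leaf).
    by rewrite (graft_node _ _ (size_caret_seq hk)) graft1.
  rewrite /caret_seq -catA cat_cons -nseqD; congr (_ ++ _ :: nseq _ _); lia.
have [/IHr[k [r' [hk hr er]]]|hr] := ltnP 1 (leaves r).
  exists (leaves l + k), (Node l r'); split; [rewrite /=; lia|rewrite /=; lia|].
  rewrite [r]er [leaves (Node _ _)]/= (_ : caret_seq (leaves l + leaves r') (leaves l + k) =
    nseq (leaves l) Leaf ++ caret_seq (leaves r') k).
    by rewrite (graft_node _ _ (size_nseq _ _)) graft1.
  rewrite /caret_seq catA -nseqD; congr (_ ++ _ :: nseq _ _); lia.
have leaf u : leaves u <= 1 -> u = Leaf.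
  by case: u => //= u v; have := lp u; have := lp v; lia.
by exists 0, Leaf; rewrite (leaf _ hl) (leaf _ hr).
Qed.

Lemma nth_right_parity_caret t k i : k < leaves t ->
  nth false (right_parity (graft t (caret_seq (leaves t) k))) i =
  add_color k (~~ nth false (right_parity t) k) (nth false (right_parity t)) i.
Proof.
move=> hk; rewrite right_parity_graft ?size_caret_seq //.
have sz := size_right_parity t; set cs := right_parity t in sz *.
have st : size (take k cs) = k by rewrite size_takel // sz ltnW.
rewrite -{1}(cat_take_drop k cs) graft_parity_cat ?size_nseq //.
rewrite (drop_nth false) ?sz // graft_parity_cons !graft_parity_leaf ?size_drop ?sz //.
rewrite nth_cat st /add_color; case: (ltnP i k) => ik.
  by rewrite nth_take // ltnW.
have [->|ik'] := eqVneq i k; first by rewrite leqnn subnn /= addbF.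
rewrite leqNgt ltn_neqAle eq_sym ik' ik /=.
have [->|ik2] := eqVneq i k.+1; first by rewrite subSnn /= addbT.
have [j ->] : exists j, i = j + k.+2 by exists (i - k.+2); lia.
by rewrite (_ : j + k.+2 - k = j.+2) /= ?nth_drop; [congr nth; lia | lia].
Qed.

(** * The Gram matrix of the tree vectors *)

Section CaretVector.
Local Open Scope ring_scope.
Variables (K : numClosedFieldType) (delta a b : K).

(** Written as an indicator function, so that it makes sense for every word; for a word that
    represents a diagram it is the basis vector (see [word_vecE]). *)
Definition word_vec m w : TL K 1 m :=
  [ffun d : diagram 1 m =>
    [forall p, top_pos (d p) == word_matching w (top_pos p)]%:R].

Lemma word_vecE m w (d : diagram 1 m) :
  represents d (word_matching w) -> word_vec m w = diagram_vec K d.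
Proof.
move=> hd; apply/ffunP => c; rewrite !ffunE; congr (nat_of_bool _)%:R.
apply/forallP/eqP => [h|-> p]; last by rewrite hd.
by apply: diagram_eq => p; apply: top_pos_inj; rewrite hd; apply/eqP.
Qed.

Lemma word_diagram n w : valid_word w -> size w = n ->
  exists d : diagram 1 n.+1.*2.-1, represents d (word_matching w).
Proof.
move=> hw sw; apply: matching_diagram; have := matching_word hw.
by rewrite sw doubleS.
Qed.

Definition caret_vec n ks : TL K 1 n.+1.*2.-1 :=
  \sum_(t <- caret_terms a b ks) t.1 *: word_vec _ t.2.

Lemma word_vec0 : word_vec 1 [::] = tl_id K 1.
Proof.
have [d dE] := id_diagram 1.
have dr : represents d (word_matching [::]).
  case=> i; rewrite (ord1 i); first by rewrite dE.
  by have -> : d (inr 0) = inl 0 by rewrite -(dE 0) diagramK.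
by rewrite (word_vecE dr) (tl_id_vec _ dE).
Qed.

Lemma tl_comp_sumr (I : Type) (r : seq I) m n k (y : TL K n k) (u : I -> K)
    (X : I -> TL K m n) :
  tl_comp delta y (\sum_(i <- r) u i *: X i) =
  \sum_(i <- r) u i *: tl_comp delta y (X i).
Proof.
elim: r => [|i r IH]; last first.
  by rewrite !big_cons -[in LHS](scale1r (\sum_(_ <- _) _)) tl_compDr IH scale1r.
have := tl_compDr delta y 0 (0 : TL K m n) 0 0.
by rewrite !big_nil !scale0r !addr0.
Qed.

Lemma tl_comp_caret_vec n ks (k : 'I_n.+1) : valid_carets ks -> size ks = n ->
  tl_comp delta (Phi_caret a b k) (caret_vec n ks) = caret_vec n.+1 (nat_of_ord k :: ks).
Proof.
move=> hks sks; rewrite tl_comp_sumr /caret_vec [caret_terms _ _ _]/= big_cat !big_map /=.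
rewrite -big_split /= big_seq [RHS]big_seq; apply: eq_bigr => t ht.
have [hw sw] := caret_terms_valid hks ht; rewrite sks in sw.
have [d hd] := word_diagram hw sw.
have hk := ltn_ord k.
have v1 : valid_word (k.*2.+1 :: t.2) by rewrite /= hw andbT sw; lia.
have v0 : valid_word (k.*2 :: t.2) by rewrite /= hw andbT sw; lia.
have [d1 hd1] := word_diagram v1 (congr1 S sw).
have [d0 hd0] := word_diagram v0 (congr1 S sw).
rewrite (word_vecE hd) (word_vecE hd1) (word_vecE hd0).
have [e1 [e0 [-> ce1 ce0]]] := Phi_caret_vec a b k.
have h1 : (k.*2.+1 <= n.+1.*2.-1)%N by lia.
have h0 : (k.*2 <= n.+1.*2.-1)%N by lia.
have hn : n.+2.*2.-1 = n.+1.*2.-1.+2 by [].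
rewrite tl_compDl (tl_comp_creates _ hn h1 ce1 hd hd1).
rewrite (tl_comp_creates _ hn h0 ce0 hd hd0).
by rewrite scalerDr !scalerA ![_ * t.1]mulrC.
Qed.

Lemma forest1P n (s : forest 1 n) : exists2 t, trees_of s = [:: t] & leaves t = n.
Proof.
have := leaves_forest s; have := size_forest s.
case: (trees_of s) => [|t [|]] //= _; rewrite /fleaves /= addn0 => h.
by exists t.
Qed.

Lemma forest1_caret n (s : forest 1 n.+2) :
  exists (k : 'I_n.+1) (s' : forest 1 n.+1), s = fcomp (fcaret k) s'.
Proof.
have [t st lt] := forest1P s; have [|k [t' [hk ht et]]] := @tree_caret t.
  by rewrite lt.
have lt' : leaves t' = n.+1 by move: ht; rewrite lt => -[].
have hs' : (size [:: t'] == 1) && (fleaves [:: t'] == n.+1)%N.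
  by rewrite /fleaves /= addn0 lt' !eqxx.
rewrite lt' in hk; exists (Ordinal hk), (Forest hs').
apply: val_inj; rewrite [LHS]st /= -/(caret_seq n.+1 k) take_oversize.
  by rewrite [in LHS]et lt'.
by rewrite size_caret_seq ?lt'.
Qed.

(** Removing carets one at a time yields both the expansion of a value of [Phi] at [s] and the
    identification of colours with parities. *)
Lemma is_Phi_caret_vec n (s : forest 1 n.+1) : exists ks,
  [/\ size ks = n, valid_carets ks, is_Phi delta a b s (caret_vec n ks) &
   forall i, nth false (right_parity (head Leaf s)) i = caret_color ks i].
Proof.
elim: n s => [|n IH] s.
  have [t st lt] := forest1P s.
  have tL : t = Leaf.
    case: t lt {st} => //= l r; have lp u : (0 < leaves u)%N.
      by elim: u => //= u hu v hv; lia.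
    by have := lp l; have := lp r; lia.
  exists [::]; split=> //; last first.
    by rewrite st tL => -[|[|i]].
  have -> : s = fid 1 by apply: val_inj; rewrite [LHS]st tL.
  rewrite /caret_vec big_seq1 scale1r /= word_vec0; exact: (Phi_id delta a b 1).
have [k [s' ->]] := forest1_caret s; have [ks [sks hks Pks cks]] := IH s'.
exists (nat_of_ord k :: ks); split.
- by rewrite /= sks.
- by rewrite /= hks sks -ltnS ltn_ord.
- by rewrite -tl_comp_caret_vec //; apply: Phi_comp => //; apply: Phi_Y.
move=> i; have [t st lt] := forest1P s'.
have -> : head Leaf (fcomp (fcaret k) s') = graft t (caret_seq (leaves t) k).
  rewrite /= st /= take_oversize ?lt //.
  by rewrite -/(caret_seq n.+1 k) size_caret_seq.
rewrite nth_right_parity_caret ?lt //=.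
have tE j : nth false (right_parity t) j = caret_color ks j.
  by rewrite -cks st.
by rewrite tE /add_color; do 2?case: ifP.
Qed.

Lemma tl_form_suml (I : Type) (r : seq I) m (u : I -> K) (X : I -> TL K 1 m) y :
  tl_form delta (\sum_(i <- r) u i *: X i) y =
  \sum_(i <- r) u i * tl_form delta (X i) y.
Proof.
elim: r => [|i r IH]; last first.
  by rewrite !big_cons -[in LHS](scale1r (\sum_(_ <- _) _)) tl_formDl IH mul1r.
have := tl_formDl delta (0 : TL K 1 m) 0 y 0 0.
by rewrite !big_nil !scale0r !mul0r !addr0.
Qed.

Lemma tl_form_sumr (I : Type) (r : seq I) m (u : I -> K) (X : I -> TL K 1 m) y :
  tl_form delta y (\sum_(i <- r) u i *: X i) =
  \sum_(i <- r) (u i)^* * tl_form delta y (X i).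
Proof.
elim: r => [|i r IH]; last first.
  by rewrite !big_cons -[in LHS](scale1r (\sum_(_ <- _) _)) tl_formDr IH conjC1 mul1r.
have := tl_formDr delta y (0 : TL K 1 m) 0 0 0.
by rewrite !big_nil !scale0r conjC0 !mul0r !addr0.
Qed.

Hypotheses (a_neq0 : a != 0) (a2 : a ^+ 2 = delta) (ab : a * b = -1)
  (delta2 : delta ^+ 2 = 2) (aC : a^* = a) (bC : b^* = b).

Lemma caret_terms_conj ks t : t \in caret_terms a b ks -> t.1^* = t.1.
Proof.
elim: ks t => [|k ks IH] t /=; first by rewrite inE => /eqP->; rewrite conjC1.
by rewrite mem_cat => /orP[] /mapP[u /IH hu ->] /=; rewrite rmorphM /= hu ?aC ?bC.
Qed.

(** Summing over the terms of [ks] first turns each term of [ks'] into its evaluation on the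
    colouring of [ks] ([sum_caret_terms_loops]). The sum over [ks'] then compares the two colourings
    ([sum_caret_terms_eval]). The coefficients are real, so conjugation does not affect them. *)
Lemma tl_form_caret_vec n ks ks' : size ks = n -> size ks' = n ->
  valid_carets ks -> valid_carets ks' ->
  tl_form delta (caret_vec n ks) (caret_vec n ks') =
  [forall i : 'I_n.+1, caret_color ks i == caret_color ks' i]%:R.
Proof.
move=> sn sn' hks hks'; have d0 : delta != 0 by rewrite -a2 expf_neq0.
have c0 : caret_color ks 0 = false by elim: (ks).
have inner t : t \in caret_terms a b ks' ->
    delta * tl_form delta (caret_vec n ks) (word_vec _ t.2) =
    color_eval delta a t.2 (caret_color ks).
  move=> ht; have [hw sw] := caret_terms_valid hks' ht; rewrite sn' in sw.
  rewrite -(sum_caret_terms_loops a_neq0 a2 ab delta2 hks hw); last by rewrite sn.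
  rewrite tl_form_suml mulr_sumr big_seq [RHS]big_seq; apply: eq_bigr => u hu.
  have [hv sv] := caret_terms_valid hks hu; rewrite sn in sv.
  have [d hd] := word_diagram hw sw; have [d' hd'] := word_diagram hv sv.
  rewrite (word_vecE hd) (word_vecE hd') mulrCA; congr (_ * _).
  rewrite (tl_form_vec delta _ _ hd' hd) ?sn //.
  - by have := matching_word hv; rewrite sv.
  - by have := matching_word hw; rewrite sw.
apply: (mulfI d0); rewrite tl_form_sumr mulr_sumr [RHS]mulrC.
have E := sum_caret_terms_eval delta a_neq0 ab hks' c0; rewrite sn' in E.
rewrite -E {E}.
rewrite big_seq [RHS]big_seq; apply: eq_bigr => t ht.
by rewrite mulrCA inner // (caret_terms_conj ht).
Qed.

Lemma tl_form_trees n (s t : forest 1 n) : exists X Y : TL K 1 n.*2.-1,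
  [/\ is_Phi delta a b s X, is_Phi delta a b t Y & tl_form delta X Y =
   (right_parity (head Leaf s) == right_parity (head Leaf t))%:R].
Proof.
have [u su lu] := forest1P s; have [v tv lv] := forest1P t.
case: n s t su lu tv lv => [|n] s t su lu tv lv.
  by have : (0 < leaves u)%N by [elim: (u) => //= l hl r hr; lia]; rewrite lu.
have [ks [ss hks Ps cs]] := is_Phi_caret_vec s.
have [ks' [ss' hks' Pt ct]] := is_Phi_caret_vec t.
exists (caret_vec n ks), (caret_vec n ks'); split=> //.
rewrite tl_form_caret_vec //; congr (nat_of_bool _)%:R.
apply/forallP/eqP => [h|h i]; last by rewrite -cs -ct h.
apply: (@eq_from_nth _ false); first by rewrite !size_right_parity su tv /= lu lv.
rewrite size_right_parity su /= lu => i hi.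
by have /eqP := h (Ordinal hi); rewrite /= -cs -ct su.
Qed.
End CaretVector.

(** * A family of elements of F *)

Lemma eq_graft_parity cs f g :
  map right_parity f = map right_parity g -> graft_parity cs f = graft_parity cs g.
Proof.
elim: f g cs => [|u f IH] [|v g] [|c cs] //= [e1 /IH e2].
by rewrite !graft_parity_cons e1 (e2 cs).
Qed.

(** Equal leaf counts cut both concatenations at the same places, where the exclusive or with [c]
    can be cancelled. *)
Lemma graft_parity_inj cs f g : size f = size cs -> size g = size cs ->
  map leaves f = map leaves g ->
  graft_parity cs f = graft_parity cs g -> map right_parity f = map right_parity g.
Proof.
elim: cs f g => [|c cs IH] [|u f] [|v g] //= [sf] [sg] [luv lfg].
rewrite !graft_parity_cons => /eqP; rewrite eqseq_cat; last first.
  by rewrite !size_map !size_right_parity.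
case/andP => /eqP /inj_map huv /eqP hfg; congr (_ :: _); last exact: IH.
by apply: huv; apply: addbI.
Qed.

(* Two trees whose leaves have pairwise equal parities of left turns, but
   not of right turns. *)
Definition tree_p := Node (Node (Node Leaf Leaf) Leaf) Leaf.
Definition tree_q := Node Leaf (Node (Node Leaf Leaf) Leaf).

Definition pq_seq (P : pred nat) n := mkseq (fun l => if P l then tree_q else tree_p) n.

Fact pq_forest_subproof P n :
  (size (pq_seq P n) == n) && (fleaves (pq_seq P n) == 4 * n).
Proof.
rewrite size_mkseq eqxx /fleaves /pq_seq /mkseq -map_comp.
rewrite (@eq_map _ _ _ (fun=> 4)) => [|l /=]; last by case: ifP.
by apply/eqP; rewrite -[in RHS](size_iota 0 n); elim: (iota _ _) => //= *; lia.
Qed.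
Definition pq_forest P n : forest n (4 * n) := Forest (pq_forest_subproof P n).

Lemma right_parity_fcomp n m (f : forest n m) (t : forest 1 n) :
  right_parity (head Leaf (fcomp f t)) =
  graft_parity (right_parity (head Leaf t)) f.
Proof.
have [u tu lu] := forest1P t; rewrite /= tu /= take_oversize ?size_forest ?lu //.
by rewrite right_parity_graft // size_forest.
Qed.

(** The right parities are 0, 1, 1, 1 for [tree_p] and 0, 1, 0, 0 for [tree_q]. *)
Lemma right_parity_pq_inj P Q n (t : forest 1 n) :
  right_parity (head Leaf (fcomp (pq_forest P n) t)) =
  right_parity (head Leaf (fcomp (pq_forest Q n) t)) ->
  forall i, i < n -> P i = Q i.
Proof.
have [u tu lu] := forest1P t.
rewrite !right_parity_fcomp => /graft_parity_inj h i hi.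
have /(congr1 (nth [::] ^~ i)) :
    map right_parity (pq_seq P n) = map right_parity (pq_seq Q n).
  apply: h; rewrite ?size_mkseq ?size_right_parity ?tu //.
  by rewrite -!map_comp; apply: eq_map => l /=; do 2?case: ifP.
by rewrite !(nth_map Leaf) ?size_mkseq // !nth_mkseq //; do 2?case: ifP.
Qed.

(** The left parities of [tree_p] and [tree_q] are both 1, 0, 1, 0, and the mirror turns left into
    right. *)
Lemma right_parity_mirror_pq P Q n (t : forest 1 n) :
  right_parity (head Leaf (fmirror (fcomp (pq_forest P n) t))) =
  right_parity (head Leaf (fmirror (fcomp (pq_forest Q n) t))).
Proof.
rewrite !fmirror_comp !right_parity_fcomp; apply: eq_graft_parity.
rewrite /= !map_rev -!map_comp; congr rev; apply: eq_map => l /=.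
by do 2?case: ifP.
Qed.

Definition pq_elt n (t : forest 1 n) i : thompsonF :=
  frac (fcomp (pq_forest pred0 n) t) (fcomp (pq_forest (pred1 i) n) t).

Lemma pq_elt_mul n (t s : forest 1 n) i :
  (pq_elt t i * frac t s)%g =
  frac (fcomp (pq_forest pred0 n) t) (fcomp (pq_forest (pred1 i) n) s).
Proof.
pose q := pq_forest (pred1 i) n.
by rewrite /pq_elt (@frac_mul _ _ _ _ _ _ _ (fid _) q) ?fcomp1f.
Qed.

Lemma frac_inv n (t s : forest 1 n) : ((frac t s)^-1 = frac s t)%g.
Proof.
apply: (mulgI (frac t s)); rewrite mulgV.
by rewrite (@frac_mul _ _ _ _ _ _ _ (fid _) (fid _)) // !fcomp1f frac_id.
Qed.

(** The common numerator cancels, which leaves two trees grown on the same tree [s]. *)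
Lemma pq_elt_quot n (t s : forest 1 n) i j :
  ((pq_elt t i * frac t s)^-1 * (pq_elt t j * frac t s))%g =
  frac (fcomp (pq_forest (pred1 i) n) s) (fcomp (pq_forest (pred1 j) n) s).
Proof.
rewrite !pq_elt_mul frac_inv.
by rewrite (@frac_mul _ _ _ _ _ _ _ (fid _) (fid _)) // !fcomp1f.
Qed.

(** Grafting a comb with [N.+1] leaves on every leaf of both trees does not change the fraction. *)
Lemma frac_large N (g : thompsonF) : exists n (t s : forest 1 n),
  N <= n /\ g = frac t s.
Proof.
elim/fracW: g => n t s; pose c := iter N (Node Leaf) Leaf.
have lc : leaves c = N.+1 by rewrite /c; elim: N {c} => //= N ->.
have hf : (size (nseq n c) == n) && (fleaves (nseq n c) == N.+1 * n).
  by rewrite size_nseq eqxx /fleaves map_nseq sumn_nseq lc eqxx.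
exists (N.+1 * n), (fcomp (Forest hf) t), (fcomp (Forest hf) s).
rewrite frac_comp; split=> //; have [u _ <-] := forest1P t.
have : 0 < leaves u by elim: u => //= l hl r hr; lia.
by nia.
Qed.

(** * Orthogonality and Bessel's inequality *)

Section Hilbert.
Local Open Scope ring_scope.
Local Open Scope classical_set_scope.
Variables (R : realType) (H : hilbert R).
Implicit Types x y z : H.

Lemma hdotC x y : hdot H x y = (hdot H y x)^*.
Proof. by rewrite hermC /= expr0 mul1r. Qed.

Lemma hdotBl x y z : hdot H (x - y) z = hdot H x z - hdot H y z.
Proof. exact: linearBl. Qed.

Lemma hdotBr x y z : hdot H z (x - y) = hdot H z x - hdot H z y.
Proof. exact: linearBr. Qed.

Lemma hdotZl c x y : hdot H (c *: x) y = c * hdot H x y.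
Proof. exact: linearZl_LR. Qed.

Lemma hdotZr c x y : hdot H x (c *: y) = c^* * hdot H x y.
Proof. exact: linearZr_LR. Qed.

Lemma hdotDr x y z : hdot H z (x + y) = hdot H z x + hdot H z y.
Proof. exact: linearDr. Qed.

Lemma hdot0l x : hdot H 0 x = 0.
Proof. exact: linear0l. Qed.

Lemma hdot_ge0 x : 0 <= hdot H x x.
Proof. by rewrite -hdotE exprn_ge0. Qed.

Lemma hdot_eq0 x : hdot H x x = 0 -> x = 0.
Proof. by rewrite -hdotE => /eqP; rewrite expf_eq0 normr_eq0 => /eqP. Qed.

Lemma unit_eq x y : hdot H x x = 1 -> hdot H y y = 1 -> hdot H x y = 1 -> x = y.
Proof.
move=> hx hy hxy; apply/eqP; rewrite -subr_eq0; apply/eqP/hdot_eq0.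
by rewrite hdotBl !hdotBr hx hy hxy hdotC hxy conjC1 !subrr.
Qed.

(** A vector [y] of [D] at distance less than the norm of [x] would contradict Pythagoras. *)
Lemma dense_orthogonal (D : set H) x :
  dense D -> (forall y, D y -> hdot H x y = 0) -> x = 0.
Proof.
move=> dD xD; apply/eqP/negPn/negP => x0.
have nx : 0 < `|x| by rewrite normr_gt0.
have [y [xy /xD hxy]] : (ball x `|x|) `&` D !=set0.
  apply: dD; last exact: ball_open.
  by exists x; apply: ballxx.
have : `|x - y| ^+ 2 < `|x| ^+ 2.
  rewrite ltr_pXn2r ?nnegrE //.
  by move: xy; rewrite -ball_normE.
rewrite !hdotE hdotBl !hdotBr hxy [hdot H y x]hdotC hxy conjC0 subr0 sub0r opprK.
rewrite -subr_gt0 opprD addrA subrr sub0r oppr_gt0 => h.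
by have := lt_le_trans h (hdot_ge0 y); rewrite ltxx.
Qed.

(** Positivity of the square norm of [x - c *: S], with [S] the sum of the [N] vectors, bounds [N]
    times the square of the modulus of [c] by the square norm of [x]. *)
Lemma bessel_unbounded x c : c != 0 ->
  (forall N, exists u : 'I_N -> H, forall i, hdot H x (u i) = c /\
     forall j, hdot H (u i) (u j) = (i == j)%:R) -> False.
Proof.
move=> c0 hN; have bound N : `|c| ^+ 2 * N%:R <= hdot H x x.
  have [u hu] := hN N; pose S := \sum_i u i.
  have xS : hdot H x S = c * N%:R.
    rewrite linear_sumr (eq_bigr (fun=> c)) => [|i _]; last by have [] := hu i.
    by rewrite sumr_const card_ord mulr_natr.
  have SS : hdot H S S = N%:R.
    rewrite linear_sumr (eq_bigr (fun=> 1)) => [|i _].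
      by rewrite sumr_const card_ord.
    rewrite linear_sumlz (bigD1 i) //= big1 => [|j /negPf nj].
      by have [_ ->] := hu i; rewrite eqxx addr0.
    by have [_ ->] := hu j; rewrite nj.
  have := hdot_ge0 (x - c *: S).
  rewrite hdotBl !hdotBr !hdotZl hdotZr hdotZr [hdot H S x]hdotC xS SS.
  rewrite [X in 0 <= X -> _](_ : _ = hdot H x x - `|c| ^+ 2 * N%:R) ?subr_ge0 //.
  by rewrite normCK rmorphM /= conjC_nat; ring.
have cpos : 0 < `|c| ^+ 2 by rewrite exprn_gt0 // normr_gt0.
(* The order of [R[i]] compares real parts, so the bound passes to [R], where the Archimedean
   property applies. *)
move: (`|c| ^+ 2) (hdot H x x) cpos bound => [A A'] [B B'].
rewrite ltcE /= => /andP[/eqP -> A0] bound.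
have hB N : A * N%:R <= B.
  have := bound N; rewrite -(rmorph_nat (real_complex R)) lecE /=.
  by move=> /andP[_]; rewrite mulr0 subr0.
have B0 : 0 <= B by have := hB 0%N; rewrite mulr0.
have := archi_boundP (divr_ge0 B0 (ltW A0)).
by rewrite ltr_pdivrMr // mulrC ltNge hB.
Qed.

End Hilbert.

(** * The vacuum vector and its stabilizer *)

Section JonesVacuum.
Local Open Scope ring_scope.
Local Open Scope classical_set_scope.
Variables (R : realType) (delta a b : R[i]).
Hypotheses (a_neq0 : a != 0) (a2 : a ^+ 2 = delta) (ab : a * b = -1)
  (delta2 : delta ^+ 2 = 2) (aC : a^* = a) (bC : b^* = b).
Variable J : jones_rep delta a b.
Let Omega : jr_space J := jr_vacuum J.
Let pi := jr_rep J.

Lemma Phi_span_id1 : Phi_span delta a b (tl_id R[i] 1 : TL _ 1 1.*2.-1).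
Proof.
exists 1%N, (fun=> 1), (fun=> tl_id _ 1); split; last by rewrite big_ord1 scale1r.
by move=> i; exists (fid 1); exact: Phi_id.
Qed.

Lemma Phi_span_Phi n (s : forest 1 n) X : is_Phi delta a b s X ->
  Phi_span delta a b X.
Proof.
move=> h; exists 1%N, (fun=> 1), (fun=> X); split; last by rewrite big_ord1 scale1r.
by move=> i; exists s.
Qed.

Lemma jr_inE n (t s : forest 1 n) X : is_Phi delta a b s X ->
  jr_in J t X = pi (frac t s) Omega.
Proof.
move=> hX; have e : fcomp (fid n) s = fcomp s (fid 1) by rewrite fcomp1f fcompf1.
have := jr_repE J t e hX Phi_span_id1.
by rewrite fcomp1f tl_comp_id.
Qed.

Lemma vacuum_frac n (s : forest 1 n) : pi (frac s s) Omega = Omega.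
Proof. by rewrite frac_id; exact: urep1. Qed.

Lemma hdot_urep g x y : hdot _ (pi g x) (pi g y) = hdot _ x y.
Proof. by have [h _] := urep_unitary pi g; exact: h. Qed.

(** Both vectors live over the same tree [t]: by [jr_inE] the first is the class of [Phi s], and
    [Omega], rewritten as the translate by [frac t t], is that of [Phi t]. The isometry then gives
    their Gram form. *)
Lemma vacuum_coeff n (t s : forest 1 n) :
  hdot _ (pi (frac t s) Omega) Omega =
  (right_parity (head Leaf s) == right_parity (head Leaf t))%:R.
Proof.
have [X [Y [hX hY <-]]] := tl_form_trees a_neq0 a2 ab delta2 aC bC s t.
rewrite -(jr_inE t hX) -(vacuum_frac t) -(jr_inE t hY).
by apply: jr_in_isometry; [exact: Phi_span_Phi hX | exact: Phi_span_Phi hY].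
Qed.

Lemma vacuum_norm : hdot _ Omega Omega = 1.
Proof. by rewrite -{1}(vacuum_frac (fid 1)) vacuum_coeff eqxx. Qed.

Lemma vacuum_stabilizerE n (t s : forest 1 n) :
  vacuum_stabilizer J (frac t s) <->
  right_parity (head Leaf s) = right_parity (head Leaf t).
Proof.
split=> [h|h]; last first.
  apply: unit_eq; rewrite ?hdot_urep ?vacuum_norm // vacuum_coeff h eqxx //.
apply/eqP; have := vacuum_coeff t s; rewrite h vacuum_norm.
by case: eqP => // _ /eqP; rewrite oner_eq0.
Qed.

(** The dense set consists of the images under [jr_in] of combinations of vectors [Phi s], and
    [jr_inE] makes each [Phi s] a translate of the vacuum. *)
Lemma vacuum_cyclic x : (forall g, hdot _ x (pi g Omega) = 0) -> x = 0.
Proof.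
move=> hx; apply: (dense_orthogonal (@jr_in_dense _ _ _ _ J)) => _ [n [t [y [hy ->]]]].
case: hy => N [c [X [hX ->]]]; elim: N c X hX => [|N IH] c X hX.
  rewrite big_ord0; have z0 : Phi_span delta a b (0 : TL _ 1 n.*2.-1).
    by exists 0%N, (fun=> 0), (fun=> 0); split; [case | rewrite big_ord0].
  (* Linearity is available only inside the span, so [jr_in] is seen to vanish at 0 by applying it
     to 0 + 0. *)
  have := jr_in_linear J t 1 z0 z0; rewrite !scale1r addr0 => /eqP.
  by rewrite addrC -subr_eq subrr => /eqP <-; rewrite linear0r.
rewrite big_ord_recl jr_in_linear.
- have [s hs] := hX ord0.
  rewrite hdotDr hdotZr (jr_inE t hs) hx mulr0 add0r.
  by apply: IH => i; apply: hX.
- by have [s hs] := hX ord0; apply: Phi_span_Phi hs.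
by exists N, (fun i => c (lift ord0 i)), (fun i => X (lift ord0 i)).
Qed.

Lemma pq_elt_sigma n (t : forest 1 n) i :
  (sigmaF @` vacuum_stabilizer J) (pq_elt t i).
Proof.
exists (sigmaF (pq_elt t i)); last exact: sigmaFK.
by rewrite /pq_elt sigmaF_frac; apply/vacuum_stabilizerE/right_parity_mirror_pq.
Qed.

Lemma pq_elt_coset n (t s : forest 1 n) (i j : 'I_n) :
  hdot _ (pi ((pq_elt t j * frac t s)^-1 * (pq_elt t i * frac t s))%g Omega) Omega
  = (i == j)%:R.
Proof.
rewrite pq_elt_quot vacuum_coeff; congr (nat_of_bool _)%:R.
apply/eqP/eqP => [/right_parity_pq_inj/(_ i (ltn_ord i))|->//].
by rewrite /= eqxx => /esym/eqP/val_inj.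
Qed.

Lemma not_quasi_conjugate :
  ~ quasi_conjugate (vacuum_stabilizer J) (sigmaF @` vacuum_stabilizer J).
Proof.
case=> g [_]; rewrite /finite_index => /finite_seqP[S hS].
(* More leaves than the supposedly finite number of cosets; the elements [e i] will lie in pairwise
   different ones. *)
have [n [t [s [hn gE]]]] := frac_large (size S).+1 (g^-1)%g.
pose e (i : 'I_n) := (g * pq_elt t i * g^-1)%g.
set C := [set (g * b * g^-1)%g | b in _] in hS.
have eC i : C (e i) by exists (pq_elt t i) => //; exact: pq_elt_sigma.
pose coset i := [set (e i * x)%g | x in vacuum_stabilizer J `&` C].
have one_AC : (vacuum_stabilizer J `&` C) 1%g.
  split; first exact: urep1.
  exists 1%g; last by rewrite mulg1 mulgV.
  exists 1%g; first exact: urep1.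
  by apply: (mulgI (sigmaF 1%g)); rewrite -gmulfM !mulg1.
have coset_inj : injective coset.
  move=> i j ij.
  have : coset i (e i) by exists 1%g; rewrite ?mulg1.
  rewrite ij => -[x [xA _] xE]; have := pq_elt_coset t s i j.
  have -> : ((pq_elt t j * frac t s)^-1 * (pq_elt t i * frac t s) = x)%g.
    rewrite -gE; apply: (mulgI (e j)); rewrite xE /e.
    by rewrite invgM invgK !mulgA mulgVK mulgK.
  move: xA; rewrite /vacuum_stabilizer /= -/Omega -/pi => ->.
  by rewrite vacuum_norm; case: eqP => // _ /eqP; rewrite oner_eq0.
have : (size (map coset (enum 'I_n)) <= size S)%N.
  apply: uniq_leq_size; first by rewrite (map_inj_uniq coset_inj) enum_uniq.
  move=> _ /mapP[i _ ->]; have : [set` S] (coset i) by rewrite -hS; exists (e i).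
  by [].
by rewrite size_map size_enum_ord leqNgt hn.
Qed.

Lemma not_unitarily_equivalent :
  ~ unitarily_equivalent (jr_rep J) (urep_pullback sigmaF (jr_rep J)).
Proof.
case=> U [[Uiso _] Uint]; pose v := U Omega.
(* The pullback acts through [sigmaF], so [U] carries the invariance of [Omega] under [k] to that of
   [v] under [sigmaF k]. *)
have vfix h : (sigmaF @` vacuum_stabilizer J) h -> pi h v = v.
  by case=> k hk <-; have := Uint k Omega; rewrite hk => <-.
have [|hg] := pselect (forall g, hdot _ v (pi g Omega) = 0).
  move/vacuum_cyclic => v0; have := Uiso Omega Omega.
  by rewrite -/v v0 hdot0l vacuum_norm => /esym/eqP; rewrite oner_eq0.
have {hg}[g /eqP hg] : exists g, hdot _ v (pi g Omega) <> 0 by apply/existsNP.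
apply: (bessel_unbounded hg) => N.
have [n [t [s [hn gE]]]] := frac_large N g; rewrite gE.
exists (fun i : 'I_N => pi (pq_elt t i * frac t s)%g Omega) => i; split.
  (* Acting by [pq_elt t i] on both arguments fixes [v], so the coefficient is the one at [frac t s]
     for every [i]. *)
  rewrite urepM -[RHS](hdot_urep (pq_elt t i)) vfix //; exact: pq_elt_sigma.
move=> j; rewrite -(hdot_urep (pq_elt t j * frac t s)^-1%g) -!urepM mulVg urep1.
rewrite (pq_elt_coset t s (widen_ord hn i) (widen_ord hn j)).
by rewrite -!(inj_eq val_inj).
Qed.
End JonesVacuum.

(** * The values of the parameters *)

Local Open Scope classical_set_scope.
Local Open Scope ring_scope.
Local Open Scope complex_scope.

Theorem theorem4p5 (R : realType)
    (J : jones_rep (Num.sqrt (2 : R))%:C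
                   ((2 : R) `^ 4^-1)%:C (- (2 : R) `^ (- 4^-1))%:C) :
  ~ quasi_conjugate (vacuum_stabilizer J) (sigmaF @` vacuum_stabilizer J) /\
  ~ unitarily_equivalent (jr_rep J) (urep_pullback sigmaF (jr_rep J)).
Proof.
have two_ge0 : 0 <= 2 :> R by [].
have root_gt0 : 0 < (2 : R) `^ 4^-1 by apply: powR_gt0.
have root_sq : ((2 : R) `^ 4^-1) ^+ 2 = Num.sqrt 2.
  rewrite -powR_mulrn ?ltW // -powRrM -powR12_sqrt //; congr (_ `^ _).
  by field.
have a0 : ((2 : R) `^ 4^-1)%:C != 0.
  by rewrite eq_complex /= eqxx andbT gt_eqF.
have a2 : ((2 : R) `^ 4^-1)%:C ^+ 2 = (Num.sqrt (2 : R))%:C.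
  by rewrite -rmorphXn /= root_sq.
have ab : ((2 : R) `^ 4^-1)%:C * (- (2 : R) `^ (- 4^-1))%:C = -1.
  by rewrite -rmorphM /= mulrN powRN mulfV ?gt_eqF // rmorphN rmorph1.
have d2 : (Num.sqrt (2 : R))%:C ^+ 2 = 2.
  by rewrite -rmorphXn /= sqr_sqrtr // rmorph_nat.
have conjE (x : R) : Num.conj x%:C = x%:C.
  by apply: conj_Creal; rewrite realE !lecE /= !eqxx le_total.
split; [exact: not_quasi_conjugate | exact: not_unitarily_equivalent].
Qed.
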